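(* Let $F$ be a divisibly closed supertropical semifield. Any full polynomial in one indeterminate over $F$ has a factorization into tangible linear factors, quadratic semitangibly-full factors, at most one linear left ghost and at most one linear right ghost, and the factorization of this kind which is minimal in ghosts is unique.
   Context: All semirings are commutative (in both operations), with zero $0_R$ and unit $1_R$. A supertropical semiring is a triple $(R,\mathcal G_0,\nu)$ where $R$ is a semiring, $\mathcal G_0=\mathcal G\cup\{0_R\}$ is a semiring ideal of $R$ (the ghost ideal; its elements are ghosts), and $\nu:R\to\mathcal G_0$ (written $a^\nu=\nu(a)$) is a semiring homomorphism with $\nu^2=\nu$ (where $\mathcal G_0$ is a semiring with unit $\nu(1_R)$), such that: $a+a=a^\nu$ for all $a$; $a+b\in\{a,b\}$ whenever $a^\nu\ne b^\nu$; and $a+b=a^\nu$ whenever $a^\nu=b^\nu$. $\mathcal G_0$ is totally ordered by $g\ge h\iff g+h=g$; write $a>_\nu b$ for $a^\nu>b^\nu$. It is a supertropical domain if the set $\mathcal T=R\setminus\mathcal G_0$ of tangible elements is a multiplicative monoid and $\nu|_{\mathcal T}:\mathcal T\to\mathcal G$ is onto; it is a supertropical semifield if moreover $\mathcal T$ is an Abelian group. The divisible closure $\bar R$ of a supertropical domain $R$ consists of formal roots $\sqrt[m]{a}$ ($a\in R$, $m\ge1$), with $\sqrt[m]{a}=\sqrt[m']{b}$ when $a^{m'n}=b^{mn}$ for some $n\ge 1$, product $\sqrt[m]{a}\sqrt[m']{b}=\sqrt[mm']{a^{m'}b^m}$, sum $\sqrt[m]{a}+\sqrt[m']{b}=\sqrt[mm']{a^{m'}+b^m}$,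 and $\nu(\sqrt[m]{a})=\sqrt[m]{a^\nu}$. $R$ is divisibly closed if $\bar R=R$ (identifying $a$ with $\sqrt[1]{a}$). Polynomials are $e$-equivalent if they define the same function $F\to F$; factorizations are understood up to $e$-equivalence. A polynomial is $e$-irreducible (irreducible) if it is not $e$-equivalent to a product of two polynomials neither of which is $e$-equivalent to a constant. A monomial $h$ of $f$ is essential if $h(a)>_\nu f_h(a)$ for some $a\in F$, where $f_h$ is the sum of the other monomials. For $f=\sum_i\alpha_i\lambda^i$, writing the group $\mathcal G$ additively, let $C_f$ be the convex hull (with rational weights) of the points $(i,\alpha_i^\nu)$ with $\alpha_i\neq 0_F$, and let $\bar C_f$ be its upper boundary. A monomial $\alpha_i\lambda^i$ is quasi-essential if $(i,\alpha_i^\nu)$ lies on $\bar C_f$ but is not a vertex of $\bar C_f$. A lattice point of $f$ is a point of $\bar C_f$ with integral first coordinate. $f$ is full if every lattice point lying on $\bar C_f$ corresponds to a monomial of $f$ that is either essential or quasi-essential, and the coefficient of every quasi-essential monomial is a ghost. A polynomial $\sum_{i=0}^t\alpha_i\lambda^i$ is semitangibly-full if it is full, $\alpha_t$ and $\alpha_0$ are tangible, and $\alpha_i$ is a ghost for all $0<i<t$. A linear left ghost is a polynomial $\lambda^\nu+a$ with $a$ tangible, where $\lambda^\nu=1_F^\nu\lambda$; a linear right ghost is a polynomial $\lambda+a^\nu$. A factorization is minimal in ghosts if it has the minimal number of irreducible quadratic factors having an essential ghost term.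
   Formalization: Assumes the ghost group nontrivial and f nonzero; factors irreducible, up to a nonzero constant (tangible unless f is all ghost with at most two monomials); uniqueness only if f has a tangible coefficient, and only up to ν unless ν is injective on tangibles. *)

(* Defs.v *)
From HB Require Import structures.
From mathcomp Require Import all_boot all_order all_algebra.
From mathcomp Require Import boolp.

Set Implicit Arguments.
Unset Strict Implicit.
Unset Printing Implicit Defensive.

Import GRing.Theory.
Local Open Scope ring_scope.

(* [ghost] is the ghost ideal G_0, so it contains 0; the set G of the nonzero
   ghosts carries no name. [nu1_ghost] says that nu 1 is the unit of the
   semiring G_0. *)
HB.mixin Record isSupertropical R of GRing.ComPzSemiRing R := {
  ghost : {pred R};
  nu : R -> R;
  ghost0 : 0 \in ghost;
  ghostD : forall a b, a \in ghost -> b \in ghost -> a + b \in ghost;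
  ghostMl : forall a b, b \in ghost -> a * b \in ghost;
  nu_ghost : forall a, nu a \in ghost;
  nu0 : nu 0 = 0;
  nuD : forall a b, nu (a + b) = nu a + nu b;
  nuM : forall a b, nu (a * b) = nu a * nu b;
  nu1_ghost : forall a, a \in ghost -> nu 1 * a = a;
  nu_idem : forall a, nu (nu a) = nu a;
  add_self : forall a, a + a = nu a;
  add_nu_neq : forall a b, nu a <> nu b -> a + b = a \/ a + b = b;
  add_nu_eq : forall a b, nu a = nu b -> a + b = nu a
}.

#[short(type="supertropicalType")]
HB.structure Definition Supertropical :=
  {R of isSupertropical R & GRing.ComPzSemiRing R}.

Definition tangible {R : supertropicalType} : {pred R} :=
  [pred a : R | a \notin ghost].

(* The base is a nontrivial semiring: 1 <> 0 holds in every supertropical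
   domain, because 1 is tangible and 0 is not. *)
HB.mixin Record Supertropical_isDomain R
    of GRing.ComNzSemiRing R & Supertropical R := {
  tangible1 : (1 : R) \in tangible;
  tangibleM : forall a b : R,
    a \in tangible -> b \in tangible -> a * b \in tangible;
  nu_tangible_neq0 : forall a : R, a \in tangible -> nu a <> 0;
  nu_tangible_onto : forall g : R, g \in ghost -> g <> 0 ->
    exists2 a : R, a \in tangible & nu a = g
}.

#[short(type="supertropicalDomainType")]
HB.structure Definition SupertropicalDomain :=
  {R of Supertropical_isDomain R & GRing.ComNzSemiRing R & Supertropical R}.

HB.mixin Record SupertropicalDomain_isSemifield R of SupertropicalDomain R := {
  tangibleV : forall a : R, a \in tangible ->
    exists2 b : R, b \in tangible & a * b = 1
}.

#[short(type="supertropicalSemifieldType")]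
HB.structure Definition SupertropicalSemifield :=
  {R of SupertropicalDomain_isSemifield R & SupertropicalDomain R}.

(* The order of G_0 is  h <= g  iff  g + h = g. *)
Definition ghost_le {R : supertropicalType} (h g : R) : Prop := g + h = g.

Definition nu_gt {R : supertropicalType} (a b : R) : Prop :=
  ghost_le (nu b) (nu a) /\ nu a <> nu b.

(* [formal_root R] with [root_eq] presents the divisible closure as a setoid;
   [FormalRoot a m] stands for the (m+1)-st root of a, so that roots of order
   at least one are exactly what is represented. *)
Record formal_root (R : Type) := FormalRoot { radicand : R; root_pred : nat }.

Definition root_order (R : Type) (r : formal_root R) : nat := (root_pred r).+1.

Definition root_eq (R : supertropicalDomainType) (r s : formal_root R) : Prop :=
  exists2 n : nat, (0 < n)%N &
    radicand r ^+ (root_order s * n) = radicand s ^+ (root_order r * n).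

Definition root1 (R : Type) (a : R) : formal_root R := FormalRoot a 0.

(* The canonical map from R to its divisible closure is a bijection. *)
Definition divisibly_closed (R : supertropicalDomainType) : Prop :=
  (forall a b : R, root_eq (root1 a) (root1 b) -> a = b) /\
  (forall r : formal_root R, exists a : R, root_eq r (root1 a)).

Section Polynomials.
Variable F : supertropicalSemifieldType.
Implicit Types (f g h p : {poly F}) (s : seq {poly F}).

Definition e_equiv p q : Prop := forall x : F, p.[x] = q.[x].

Definition e_constant p : Prop := exists c : F, e_equiv p c%:P.

Definition e_irreducible p : Prop :=
  ~ exists g h, [/\ e_equiv p (g * h), ~ e_constant g & ~ e_constant h].

Definition monomial f (k : nat) : {poly F} := f`_k *: 'X^k.

Definition other_monomials f (k : nat) : {poly F} :=
  \sum_(i < size f | i != k :> nat) monomial f i.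

Definition essential f (k : nat) : Prop :=
  exists a : F, nu_gt (monomial f k).[a] (other_monomials f k).[a].

(* C_f. A point has a rational abscissa and an ordinate in G. The weight of
   (i, nu f`_i) is n i / N, where N is the sum of the n i. As G is written
   multiplicatively here, the ordinate of the weighted mean is the element y of
   G with y ^+ N equal to the product of the (nu f`_i) ^+ n i; y is unique since
   a totally ordered group is torsion-free, and it exists when F is divisibly
   closed. *)
Definition hull f (P : rat * F) : Prop :=
  [/\ P.2 \in ghost, P.2 <> 0 &
    exists n : 'I_(size f) -> nat,
      let N := (\sum_(i < size f) n i)%N in
      [/\ (0 < N)%N,
          forall i : 'I_(size f), f`_i = 0 -> n i = 0%N,
          N%:R * P.1 = \sum_(i < size f) (n i * i)%:R &
          P.2 ^+ N = \prod_(i < size f) nu f`_i ^+ n i]].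

Definition upper_boundary f (P : rat * F) : Prop :=
  hull f P /\ forall y : F, hull f (P.1, y) -> ghost_le y P.2.

(* P lies strictly inside the segment [Q1, Q2], with weights n1 / (n1 + n2) and
   n2 / (n1 + n2). *)
Definition strictly_between (Q1 Q2 P : rat * F) : Prop :=
  Q1 <> Q2 /\ exists n1 n2 : nat,
    [/\ (0 < n1)%N, (0 < n2)%N,
        (n1 + n2)%:R * P.1 = n1%:R * Q1.1 + n2%:R * Q2.1 &
        P.2 ^+ (n1 + n2) = Q1.2 ^+ n1 * Q2.2 ^+ n2].

Definition vertex f (P : rat * F) : Prop :=
  upper_boundary f P /\
  forall Q1 Q2, upper_boundary f Q1 -> upper_boundary f Q2 ->
    ~ strictly_between Q1 Q2 P.

Definition coef_point f (k : nat) : rat * F := (k%:R, nu f`_k).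

Definition quasi_essential f (k : nat) : Prop :=
  [/\ f`_k <> 0, upper_boundary f (coef_point f k) &
      ~ vertex f (coef_point f k)].

Definition full f : Prop :=
  (forall (k : nat) (y : F), upper_boundary f (k%:R, y) ->
     [/\ f`_k <> 0, y = nu f`_k & essential f k \/ quasi_essential f k]) /\
  (forall k : nat, quasi_essential f k -> f`_k \in ghost).

Definition semitangibly_full f : Prop :=
  [/\ full f, lead_coef f \in tangible, f`_0 \in tangible &
      forall i : nat, (0 < i < (size f).-1)%N -> f`_i \in ghost].

(* The constant term may vanish: the indeterminate is a tangible linear
   polynomial. *)
Definition tangible_linear p : Prop :=
  size p = 2%N /\ forall i : nat, p`_i <> 0 -> p`_i \in tangible.

Definition semitangibly_full_quadratic p : Prop :=
  size p = 3%N /\ semitangibly_full p.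

Definition linear_left_ghost p : Prop :=
  exists2 a : F, a \in tangible & p = nu 1 *: 'X + a%:P.

Definition linear_right_ghost p : Prop :=
  exists2 a : F, a \in tangible & p = 'X + (nu a)%:P.

Definition ghost_quadratic p : Prop :=
  [/\ size p = 3%N, e_irreducible p &
      exists i : nat, essential p i /\ p`_i \in ghost].

(* [s] lists the nonconstant factors and [c] collects the constant ones, which
   are trivial factors in the sense of [e_irreducible]. *)
Definition factorization f (c : F) s : Prop :=
  [/\ c <> 0,
      e_equiv f (c *: \prod_(g <- s) g),
      forall g, g \in s -> e_irreducible g /\
        [\/ tangible_linear g, semitangibly_full_quadratic g,
            linear_left_ghost g | linear_right_ghost g],
      (count (fun g => `[< linear_left_ghost g >]) s <= 1)%N &
      (count (fun g => `[< linear_right_ghost g >]) s <= 1)%N].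

Definition ghost_count s : nat := count (fun g => `[< ghost_quadratic g >]) s.

Definition minimal_in_ghosts f (c : F) s : Prop :=
  factorization f c s /\
  forall c' s', factorization f c' s' -> (ghost_count s <= ghost_count s')%N.

Definition e_associate g h : Prop :=
  exists2 u : F, u \in tangible & e_equiv g (u *: h).

(* [e_associate] with tangible values compared through nu only; the two
   relations coincide when nu is injective on the tangible elements. *)
Definition nu_associate g h : Prop :=
  exists2 u : F, u \in tangible & forall x : F,
    nu g.[x] = nu (u *: h).[x] /\ (g.[x] \in ghost) = ((u *: h).[x] \in ghost).

Definition same_factors (E : {poly F} -> {poly F} -> Prop) s s' : Prop :=
  exists2 s'', perm_eq s'' s' &
    size s = size s'' /\ forall i : nat, (i < size s)%N -> E s`_i s''`_i.

End Polynomials.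

(* Main.v *)
Require Import Defs.
From HB Require Import structures.
From mathcomp Require Import all_boot all_order all_algebra.
From mathcomp Require Import ring lra zify boolp.

Set Implicit Arguments.
Unset Strict Implicit.
Unset Printing Implicit Defensive.

Import Order.TTheory GRing.Theory Num.Theory.
Local Open Scope ring_scope.

(** The function of a full polynomial consists of its values up to [nu] and of
    the set of tangible points at which it is a ghost.

    Up to [nu], it is the function of a product of linear polynomials: the
    coefficients are log-concave ([full_concave]), so the quotients of
    consecutive coefficients form an increasing sequence, and these are the
    corner roots. The ghost set consists of the corner roots and, for each ghost
    coefficient, of the interval between the two roots next to it
    ([eval_corners]).

    An admissible irreducible factor is a ghost exactly on an interval of values:
    a point for a tangible linear factor, a closed interval with two distinct
    endpoints for a quadratic one, a half-line to the right for a left ghost and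
    a half-line to the left for a right ghost. The interval determines the factor
    up to a tangible unit and up to [nu] ([factor_interval],
    [interval_associate]), the ghost set of a product is the union of the
    intervals of the factors ([gi_prod_ghost]), and the roots of the factors are
    the corner roots of the product with their multiplicities ([roots_perm]).

    Existence. The roots and ghost coefficients, read from the left, group into
    maximal runs ([ghost_runs]); each run gives one interval, and its inner roots
    give tangible linear factors. The roots are represented by quotients of
    tangible representatives of the coefficients. Their products telescope, so
    that the tangible values of the product are those of f itself and not only
    up to [nu] ([reduced_factorization]). If every coefficient is a ghost, a left
    ghost at the smallest root and a right ghost at the largest one cover the
    line and no quadratic factor occurs ([ghost_factorization]).

    Uniqueness. The intervals obtained from the runs are pairwise disjoint. The
    values are densely ordered, so finitely many points cover no nondegenerate
    interval. Hence each nondegenerate interval of any other factorization lies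
    in one of the runs ([inside_separated]), and each run contains one of them.
    So the runs give the least number of quadratic factors ([count_quad_le]), and
    a factorization with this number of quadratic factors has the same
    nondegenerate intervals ([thick_perm]). The linear factors are then the
    remaining corner roots ([intervals_perm]). *)

(** * The ordered set of values *)
Definition gval (R : supertropicalType) := {x : R | x \in ghost}.

HB.instance Definition _ (R : supertropicalType) := Choice.on (gval R).

Section GhostOrder.
Variable R : supertropicalType.
Implicit Types (g h k : gval R) (a b : R).

(** The value of [a], as a member of a type that carries the total order. Values
    are compared in this type, and multiplied by multiplying representatives. *)
Definition nuv a : gval R := exist _ (nu a) (nu_ghost a).

Lemma nuE a : nu a = nu 1 * a.
Proof. by rewrite -!add_self mulrDl mul1r. Qed.

Lemma nu_id a : a \in ghost -> nu a = a.
Proof. by move=> /nu1_ghost; rewrite -nuE. Qed.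

Lemma nuvP a b : nuv a = nuv b <-> nu a = nu b.
Proof.
split=> [/(congr1 val) // | h]; exact: val_inj.
Qed.

Lemma nuv_val g : nuv (val g) = g.
Proof. by apply/val_inj => /=; rewrite nu_id //; case: g. Qed.

Definition gval_le g h := val h + val g == val h.

Lemma gval_le_refl : reflexive gval_le.
Proof. by move=> g; rewrite /gval_le add_self nu_id ?eqxx //; case: g. Qed.

Lemma gval_le_anti : antisymmetric gval_le.
Proof.
move=> g h /andP[/eqP e1 /eqP e2]; apply: val_inj.
by rewrite -e2 addrC e1.
Qed.

Lemma gval_le_trans : transitive gval_le.
Proof.
move=> h g k /eqP e1 /eqP e2; apply/eqP.
by rewrite -e2 -addrA e1.
Qed.

Lemma gval_le_total : total gval_le.
Proof.
move=> g h; rewrite /gval_le; case: (eqVneq g h) => [->|ne].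
  by rewrite add_self nu_id ?eqxx //; case: h.
have ne' : nu (val g) <> nu (val h).
  by move=> /nuvP; rewrite !nuv_val => e; rewrite e eqxx in ne.
have [->|e] := add_nu_neq _ _ ne'; first by rewrite eqxx orbT.
by rewrite addrC e eqxx.
Qed.

End GhostOrder.

HB.instance Definition _ (R : supertropicalType) :=
  Order.Le_isPOrder.Build ring_display (gval R)
    (@gval_le_refl R) (@gval_le_anti R) (@gval_le_trans R).
HB.instance Definition _ (R : supertropicalType) :=
  Order.POrder_isTotal.Build ring_display (gval R) (@gval_le_total R).

(** * Addition and ghost surpassing *)
Section Addition.
Variable R : supertropicalType.
Implicit Types a b c : R.

Lemma nuv_le a b : (nuv a <= nuv b) = (nu b + nu a == nu b).
Proof. by []. Qed.

Lemma nuv_nu a : nuv (nu a) = nuv a.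
Proof. by apply/nuvP; rewrite nu_idem. Qed.

Lemma nu_mul_nu a b : nu a * nu b = a * nu b.
Proof. by rewrite -nuM [nu (a * b)]nuE [nu b]nuE mulrCA. Qed.

Lemma nuv0_le a : nuv 0 <= nuv a.
Proof. by rewrite nuv_le nu0 addr0. Qed.

Lemma add_veq a b : nuv a = nuv b -> a + b = nu a.
Proof. by move=> /nuvP; apply: add_nu_eq. Qed.

Lemma add_vlt a b : nuv a < nuv b -> a + b = b.
Proof.
move=> lt; have ne : nu a <> nu b.
  by move=> /nuvP e; rewrite e ltxx in lt.
have [e|//] := add_nu_neq _ _ ne.
by move: lt; rewrite ltNge nuv_le -nuD e eqxx.
Qed.

Lemma add_vgt a b : nuv b < nuv a -> a + b = a.
Proof. by rewrite addrC; apply: add_vlt. Qed.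

Lemma nuvD a b : nuv (a + b) = Order.max (nuv a) (nuv b).
Proof.
case: (ltgtP (nuv a) (nuv b)) => [/add_vlt->|/add_vgt->|/[dup] e /add_veq->] //.
by rewrite nuv_nu.
Qed.

Lemma nuvM_le a b c d : nuv a <= nuv b -> nuv c <= nuv d -> nuv (a * c) <= nuv (b * d).
Proof.
have mono (x y z : R) : nuv x <= nuv y -> nuv (x * z) <= nuv (y * z).
  by rewrite !nuv_le !nuM => /eqP e; rewrite -mulrDl e.
move=> /mono ab /mono cd; apply: le_trans (ab _) _.
by rewrite ![b * _]mulrC.
Qed.

Lemma nuvM_eq a b c d : nuv a = nuv b -> nuv c = nuv d -> nuv (a * c) = nuv (b * d).
Proof. by move=> /nuvP ab /nuvP cd; apply/nuvP; rewrite !nuM ab cd. Qed.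

Lemma nuvX_le a b n : nuv a <= nuv b -> nuv (a ^+ n) <= nuv (b ^+ n).
Proof. by move=> ab; elim: n => // n IH; rewrite !exprS; apply: nuvM_le. Qed.

Lemma nuvX_eq a b n : nuv a = nuv b -> nuv (a ^+ n) = nuv (b ^+ n).
Proof. by move=> ab; elim: n => // n IH; rewrite !exprS; apply: nuvM_eq. Qed.

Lemma nuv_sum_le (I : Type) (s : seq I) (P : pred I) (f : I -> R) b :
  (forall i, P i -> nuv (f i) <= nuv b) -> nuv (\sum_(i <- s | P i) f i) <= nuv b.
Proof.
move=> le; elim/big_ind: _ => [|x y xb yb|//]; first exact: nuv0_le.
by rewrite nuvD ge_max xb.
Qed.

Lemma ghostM a b : a \in ghost -> a * b \in ghost.
Proof. by rewrite mulrC; apply: ghostMl. Qed.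

Lemma nuv_inj_ghost a b : a \in ghost -> b \in ghost -> nuv a = nuv b -> a = b.
Proof. by move=> ga gb /nuvP; rewrite !nu_id. Qed.

(** The part of the ghost surpassing relation between elements of equal value.
    It is a congruence, and by [surp_eq] two elements that surpass the same one
    are equal as soon as both or neither are ghosts. Equality of functions is
    thereby reduced to equality of ghost sets. *)
Definition surp a b := a = b \/ a = nu b.

Lemma surp_refl a : surp a a.
Proof. by left. Qed.

Lemma surp_nuv a b : surp a b -> nuv a = nuv b.
Proof. by case=> -> //; rewrite nuv_nu. Qed.

Lemma surpM a b c d : surp a b -> surp c d -> surp (a * c) (b * d).
Proof.
case=> -> [] ->; first exact: surp_refl.
- by right; rewrite [nu (_ * _)]nuE [nu d]nuE mulrCA.
- by right; rewrite [nu (_ * _)]nuE [nu b]nuE mulrA.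
- by right; rewrite nuM.
Qed.

Lemma surpD a b c d : surp a b -> surp c d -> surp (a + c) (b + d).
Proof.
move=> ab cd; have [va vc] := (surp_nuv ab, surp_nuv cd).
case: (ltgtP (nuv b) (nuv d)) => [lt|gt|e].
- by rewrite (add_vlt lt) add_vlt // va vc.
- by rewrite (add_vgt gt) add_vgt // va vc.
- rewrite (add_veq e) add_veq ?va ?vc //; left.
  by apply/nuvP; rewrite va.
Qed.

Lemma surp_eq a b c : surp a c -> surp b c ->
  (a \in ghost) = (b \in ghost) -> a = b.
Proof.
case=> ->; case=> -> //; rewrite nu_ghost; last by move=> /esym/nu_id.
by move=> /nu_id.
Qed.

End Addition.

(** * Tangible representatives and strict monotonicity *)
Section Semifield.
Variable F : supertropicalSemifieldType.
Implicit Types a b c d x y : F.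

Lemma tangibleN a : (a \in tangible) = (a \notin ghost).
Proof. by []. Qed.

Lemma tangible_neq0 a : a \in tangible -> a != 0.
Proof. by apply: contraL => /eqP->; rewrite inE /= ghost0. Qed.

Lemma nuv_eq0 a : (nuv a == nuv 0) = (a == 0).
Proof.
apply/eqP/eqP => [/nuvP|-> //]; rewrite nu0 => a0.
case: (boolP (a \in ghost)) => [/nu_id <- //|ta].
by case: (nu_tangible_neq0 a ta a0).
Qed.

Lemma nuv_gt0 a : (nuv 0 < nuv a) = (a != 0).
Proof. by rewrite lt_neqAle nuv0_le andbT eq_sym nuv_eq0. Qed.

(** A ghost has no inverse for 1, but it has a tangible inverse for the unit
    [nu 1] of the ghosts; for a tangible [a] the second case cannot occur. *)
Definition is_inv a b := (b \in tangible) && ((a * b == 1) || (a * b == nu 1)).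

Lemma is_inv_exists a : a != 0 -> exists b, is_inv a b.
Proof.
rewrite /is_inv => a0; case: (boolP (a \in ghost)) => ga.
  have [b tb <-] := nu_tangible_onto a ga (elimN eqP a0).
  have [c tc bc] := tangibleV b tb.
  by exists c; rewrite tc nuE -mulrA bc mulr1 eqxx orbT.
by have [c tc e] := tangibleV a ga; exists c; rewrite tc e eqxx.
Qed.

Definition tinv a : F :=
  if pselect (exists b, is_inv a b) is left h then sval (cid h) else 0.

Lemma tinvP a : a != 0 -> is_inv a (tinv a).
Proof.
move=> a0; rewrite /tinv; case: pselect => [h|[]]; last exact: is_inv_exists.
exact: (svalP (cid h)).
Qed.

Lemma tangible_tinv a : a != 0 -> tinv a \in tangible.
Proof. by move=> /tinvP/andP[]. Qed.

Lemma tinv_neq0 a : a != 0 -> tinv a != 0.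
Proof. by move=> /tangible_tinv/tangible_neq0. Qed.

Lemma mulV a : a \in tangible -> a * tinv a = 1.
Proof.
move=> ta; have /andP[ti /orP[/eqP//|/eqP e]] := tinvP (tangible_neq0 ta).
by have := tangibleM _ _ ta ti; rewrite e tangibleN nu_ghost.
Qed.

Lemma nuv_mulV a : a != 0 -> nuv (a * tinv a) = nuv 1.
Proof. by move=> /tinvP/andP[_ /orP[] /eqP ->] //; rewrite nuv_nu. Qed.

(** The double inverse is tangible and has the value of [a]; it is [a] itself
    when [a] is tangible. *)
Definition tlift a := tinv (tinv a).

Lemma tangible_tlift a : a != 0 -> tlift a \in tangible.
Proof. by move=> /tinv_neq0/tangible_tinv. Qed.

Lemma surp_tlift a : a != 0 -> surp a (tlift a).
Proof.
move=> a0; have ti := tangible_tinv a0; have il := mulV ti.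
have /andP[_ /orP[] /eqP e] := tinvP a0; [left | right].
  by rewrite -[tlift a]mul1r -e -mulrA il mulr1.
by rewrite nuE -e -mulrA il mulr1.
Qed.

Lemma nuv_tlift a : a != 0 -> nuv (tlift a) = nuv a.
Proof. by move=> /surp_tlift/surp_nuv. Qed.

Lemma mul_eq0 a b : (a * b == 0) = (a == 0) || (b == 0).
Proof.
apply/eqP/idP => [ab|/orP[]/eqP->]; rewrite ?mul0r ?mulr0 //.
case: (eqVneq a 0) => //= a0; apply/negP => /negP b0.
have : nuv ((a * b) * (tinv a * tinv b)) = nuv 1.
  rewrite mulrACA -[1 in RHS]mulr1.
  by apply: nuvM_eq; apply: nuv_mulV.
rewrite ab mul0r => /esym/eqP; rewrite nuv_eq0.
by rewrite (negbTE (tangible_neq0 tangible1)).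
Qed.

Lemma mul_neq0 a b : a != 0 -> b != 0 -> a * b != 0.
Proof. by rewrite mul_eq0 negb_or => -> ->. Qed.

Lemma exp_neq0 a n : a != 0 -> a ^+ n != 0.
Proof.
move=> a0; elim: n => [|n IH]; first exact: tangible_neq0 tangible1.
by rewrite exprS mul_neq0.
Qed.

Lemma tangibleX a n : a \in tangible -> a ^+ n \in tangible.
Proof.
by move=> ta; elim: n => [|n IH]; rewrite ?tangible1 // exprS tangibleM.
Qed.

Lemma nu_neq0 a : a != 0 -> nu a != 0.
Proof. by rewrite -!nuv_eq0 nuv_nu. Qed.

Lemma ghost_mul a b :
  a != 0 -> b != 0 -> (a * b \in ghost) = (a \in ghost) || (b \in ghost).
Proof.
move=> a0 b0; apply/idP/idP => [|/orP[] h]; [|exact: ghostM|exact: ghostMl].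
by apply: contraTT; rewrite negb_or => /andP[ta tb]; apply: tangibleM.
Qed.

Lemma nuvM_le2r a b c : c != 0 -> (nuv (a * c) <= nuv (b * c)) = (nuv a <= nuv b).
Proof.
move=> c0; apply/idP/idP => [le|/nuvM_le->//].
have eqv d : nuv (d * c * tinv c) = nuv d.
  by rewrite -mulrA -[d in RHS]mulr1; apply: nuvM_eq => //; apply: nuv_mulV.
by rewrite -[nuv a]eqv -[nuv b]eqv; apply: nuvM_le.
Qed.

Lemma nuvM_lt2r a b c : c != 0 -> (nuv (a * c) < nuv (b * c)) = (nuv a < nuv b).
Proof. by move=> c0; rewrite !ltNge nuvM_le2r. Qed.

Lemma nuvM_eq2r a b c : c != 0 -> (nuv (a * c) == nuv (b * c)) = (nuv a == nuv b).
Proof. by move=> c0; rewrite !eq_le !nuvM_le2r. Qed.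

Lemma nuvM_le2l a b c : c != 0 -> (nuv (c * a) <= nuv (c * b)) = (nuv a <= nuv b).
Proof. by rewrite ![c * _]mulrC; apply: nuvM_le2r. Qed.

Lemma nuvM_lt2l a b c : c != 0 -> (nuv (c * a) < nuv (c * b)) = (nuv a < nuv b).
Proof. by rewrite ![c * _]mulrC; apply: nuvM_lt2r. Qed.

Lemma nuvM_eq2l a b c : c != 0 -> (nuv (c * a) == nuv (c * b)) = (nuv a == nuv b).
Proof. by rewrite ![c * _]mulrC; apply: nuvM_eq2r. Qed.

Lemma nuvM_lt a b c d :
  nuv a < nuv b -> nuv c <= nuv d -> d != 0 -> nuv (a * c) < nuv (b * d).
Proof.
move=> ab cd d0; apply: le_lt_trans (nuvM_le (lexx _) cd) _.
by rewrite nuvM_lt2r.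
Qed.

Lemma lt_v_neq0 a b : nuv a < nuv b -> b != 0.
Proof. by move=> /(le_lt_trans (nuv0_le a)); rewrite nuv_gt0. Qed.

Lemma nuvX_lt a b n : (0 < n)%N -> nuv a < nuv b -> nuv (a ^+ n) < nuv (b ^+ n).
Proof.
case: n => // n _ ab; rewrite !exprS; apply: nuvM_lt => //.
  exact/nuvX_le/ltW.
exact/exp_neq0/(lt_v_neq0 ab).
Qed.

Lemma nuvX_le2 a b n : (0 < n)%N -> (nuv (a ^+ n) <= nuv (b ^+ n)) = (nuv a <= nuv b).
Proof.
move=> n0; apply/idP/idP => [|/nuvX_le //].
by rewrite leNgt; apply: contraNle => /(nuvX_lt n0).
Qed.

Lemma nuvX_lt2 a b n : (0 < n)%N -> (nuv (a ^+ n) < nuv (b ^+ n)) = (nuv a < nuv b).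
Proof. by move=> n0; rewrite !ltNge nuvX_le2. Qed.

Section Dense.
Hypothesis hF : divisibly_closed F.

Lemma nth_root_exists a n : (0 < n)%N -> exists b, b ^+ n = a.
Proof.
case: n => // n _; have [b [m m0 e]] := hF.2 (FormalRoot a n).
exists b; move: e; rewrite /root_order /= mul1n exprM => e.
apply/esym/hF.1; exists m => //=; rewrite mul1n.
by rewrite e.
Qed.

(** The geometric mean of the bounds lies strictly between them. *)
Lemma nuv_dense (g h : gval F) : nuv 0 < g -> g < h ->
  exists x, [/\ x \in tangible, g < nuv x & nuv x < h].
Proof.
rewrite -[g]nuv_val -[h]nuv_val; move: (val g) (val h) => a b a0 ab.
have b0 := lt_v_neq0 ab; rewrite nuv_gt0 in a0.
have [c e] := @nth_root_exists (a * b) 2 isT.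
have c0 : c != 0.
  by apply: contra_neq (mul_neq0 a0 b0) => c0; rewrite -e c0 expr0n.
exists (tlift c); rewrite tangible_tlift // nuv_tlift //; split=> //.
  by rewrite -(@nuvX_lt2 _ _ 2) // e expr2 nuvM_lt2l.
by rewrite -(@nuvX_lt2 _ _ 2) // e expr2 nuvM_lt2r.
Qed.

Hypothesis hG : exists2 a : F, a \in tangible & nu a <> nu 1.

Lemma ex_gt1 : exists2 x : F, x \in tangible & nuv 1 < nuv x.
Proof.
have [a ta ne] := hG; case: (ltgtP (nuv (1 : F)) (nuv a)) => [|lt|/nuvP/esym//].
  by exists a.
have a0 := tangible_neq0 ta.
exists (tinv a); first exact: tangible_tinv.
by rewrite -(nuvM_lt2l _ _ a0) mulr1 nuv_mulV.
Qed.

Lemma nuv_gt_ex (g : gval F) : exists2 x, x \in tangible & g < nuv x.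
Proof.
have [x tx x1] := ex_gt1; have x0 := tangible_neq0 tx.
rewrite -[g]nuv_val; move: (val g) => a.
case: (eqVneq a 0) => [->|a0]; first by exists x; rewrite ?nuv_gt0.
exists (tlift a * x); first by rewrite tangibleM ?tangible_tlift.
rewrite -(nuv_tlift a0) -[tlift a in X in X < _]mulr1.
by rewrite nuvM_lt2l ?tangible_neq0 ?tangible_tlift.
Qed.

Lemma nuv_lt_ex (g : gval F) : nuv 0 < g -> exists2 x, x \in tangible & nuv x < g.
Proof.
rewrite -[g]nuv_val; move: (val g) => a; rewrite nuv_gt0 => a0.
have [x tx] := nuv_gt_ex (nuv (tinv a)); have x0 := tangible_neq0 tx.
rewrite -(nuvM_lt2l _ _ a0) nuv_mulV // => h; exists (tinv x).
  exact: tangible_tinv.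
by rewrite -(nuvM_lt2r _ _ x0) mulrC nuv_mulV.
Qed.

Lemma nuv_between (g h : gval F) : g < h ->
  exists x, [/\ x \in tangible, g < nuv x & nuv x < h].
Proof.
move=> gh; case: (ltgtP (nuv (0 : F)) g) => [g0||g0].
- exact: nuv_dense.
- by rewrite ltNge -[g]nuv_val nuv0_le.
- by rewrite -g0 in gh *; have [x tx xh] := nuv_lt_ex gh; exists x;
    rewrite nuv_gt0 tangible_neq0.
Qed.

(** Finitely many points do not accumulate at [g]. The point found here lies to
    the right of [g] in general position with respect to [E], which replaces all
    topological arguments about the line of values. *)
Lemma just_after (g h : gval F) (E : seq (gval F)) : g < h ->
  exists x, [/\ x \in tangible, g < nuv x, nuv x < h &
    forall e, e \in E -> g < e -> nuv x < e].
Proof.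
move=> gh; elim: E => [|e E [x [tx gx xh xE]]].
  by have [x [tx gx xh]] := nuv_between gh; exists x.
case: (ltP (nuv x) e) => [xe|ex].
  by exists x; split=> // e'; rewrite inE => /predU1P[->|/xE].
case: (ltP g e) => ge; last first.
  exists x; split=> // e'; rewrite inE => /predU1P[->|/xE] //.
  by move/(lt_le_trans) => /(_ _ ge); rewrite ltxx.
have [y [ty gy ye]] := nuv_between ge.
have yx := lt_le_trans ye ex; exists y; split=> //; first exact: lt_trans xh.
move=> e'; rewrite inE => /predU1P[->|/xE h' /h'] //; exact: lt_trans.
Qed.

Lemma just_before (g h : gval F) (E : seq (gval F)) : g < h ->
  exists x, [/\ x \in tangible, g < nuv x, nuv x < h &
    forall e, e \in E -> e < h -> e < nuv x].
Proof.
move=> gh; elim: E => [|e E [x [tx gx xh xE]]].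
  by have [x [tx gx xh]] := nuv_between gh; exists x.
case: (ltP e (nuv x)) => [xe|ex].
  by exists x; split=> // e'; rewrite inE => /predU1P[->|/xE].
case: (ltP e h) => ge; last first.
  exists x; split=> // e'; rewrite inE => /predU1P[->|/xE] //.
  by move/(lt_le_trans) => /(_ _ ge); rewrite ltxx.
have [y [ty gy ye]] := nuv_between ge.
have yx := le_lt_trans ex gy; exists y; split=> //; first exact: lt_trans yx.
move=> e'; rewrite inE => /predU1P[->|/xE h' /h'] //; move/lt_trans; exact.
Qed.

End Dense.
End Semifield.

(** * Polynomial functions *)
Section PolyFunctions.
Variable F : supertropicalSemifieldType.
Implicit Types (a b c x y : F) (p q r g h : {poly F}).

Lemma nuv_horner_mono p x y : nuv x <= nuv y -> nuv p.[x] <= nuv p.[y].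
Proof.
move=> xy; elim/poly_ind: p => [|p c IH]; first by rewrite !horner0.
rewrite !hornerD !hornerM !hornerX !hornerC !nuvD ge_max !le_max.
by rewrite nuvM_le //= lexx orbT.
Qed.

Lemma nu_horner_nu p x : nu p.[nu x] = nu p.[x].
Proof.
elim/poly_ind: p => [|p c IH]; first by rewrite !horner0.
by rewrite !hornerD !hornerM !hornerX !hornerC !nuD !nuM IH nu_idem.
Qed.

Lemma nuv_coef_le p k x : nuv (p`_k * x ^+ k) <= nuv p.[x].
Proof.
case: (ltnP k (size p)) => kp; last by rewrite nth_default // mul0r nuv0_le.
by rewrite horner_coef (bigD1 (Ordinal kp)) //= nuvD le_max lexx.
Qed.

Lemma poly_tail p : exists r, p = r * 'X + (p`_0)%:P.
Proof.
elim/poly_ind: p => [|p c _].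
  by exists 0; rewrite coef0 mul0r add0r.
by exists p; rewrite coefD coefMX coefC eqxx add0r.
Qed.

Lemma poly_size_mul g h :
  g != 0 -> h != 0 -> size (g * h) = (size g + size h).-1.
Proof.
by move=> g0 h0; apply: size_proper_mul; rewrite mul_neq0 ?lead_coef_eq0.
Qed.

Section Nontrivial.
Hypothesis hF : divisibly_closed F.
Hypothesis hG : exists2 a : F, a \in tangible & nu a <> nu 1.

Lemma nuv_small_tail r b : b != 0 -> exists2 y0, y0 \in tangible &
  forall y, nuv y <= nuv y0 -> nuv (r.[y] * y) < nuv b.
Proof.
move=> b0; have [c [c0 cb]] : exists c, c != 0 /\ nuv (r.[1] * c) < nuv b.
  case: (eqVneq r.[1] 0) => [->|r0].
    by exists b; rewrite mul0r nuv_gt0.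
  have := nuv_lt_ex hG (g := nuv (b * tinv r.[1])).
  rewrite nuv_gt0 mul_neq0 ?tinv_neq0 // => /(_ isT)[c tc cb].
  exists c; split; first exact: tangible_neq0.
  rewrite -(nuvM_lt2l _ _ (tinv_neq0 r0)) mulrA.
  rewrite [_ * b]mulrC; apply: le_lt_trans cb.
  rewrite -[X in _ <= nuv X]mul1r; apply: nuvM_le => //.
  by rewrite mulrC nuv_mulV.
have c1 : nuv 0 < Order.min (nuv c) (nuv 1).
  by rewrite lt_min !nuv_gt0 c0 tangible_neq0 ?tangible1.
have [y0 ty0] := nuv_lt_ex hG c1; rewrite lt_min => /andP[y0c y01].
exists y0 => // y yy0; apply: le_lt_trans cb; apply: nuvM_le.
  exact/nuv_horner_mono/(le_trans yy0)/ltW.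
exact/(le_trans yy0)/ltW.
Qed.

(** Near 0 the constant term dominates, so it can be recovered from tangible
    points. *)
Lemma coef0_eq p q :
  (forall x, x \in tangible -> p.[x] = q.[x]) -> p`_0 = q`_0.
Proof.
wlog p0 : p q / p`_0 != 0 => [hw|] pq.
  case: (eqVneq p`_0 0) => [p0|]; last by move=> /hw; apply.
  case: (eqVneq q`_0 0) => [->//|q0].
  by apply/esym/(hw _ _ q0) => x /pq.
have [r er] := poly_tail p; have [s es] := poly_tail q.
have [y1 t1 h1] := nuv_small_tail r p0.
have pE y : nuv y <= nuv y1 -> p.[y] = p`_0.
  move=> /h1 lt; rewrite er !hornerD !hornerM hornerX !hornerC add_vlt //.
  by rewrite -er.
have [y2 t2 h2] : exists2 y2, y2 \in tangible & forall y, nuv y <= nuv y2 ->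
    nuv (s.[y] * y) < nuv (if q`_0 == 0 then p`_0 else q`_0).
  by apply: nuv_small_tail; case: ifP => // ->.
have [y ty yle] : exists2 y, y \in tangible & nuv y <= nuv y1 /\ nuv y <= nuv y2.
  by case: (leP (nuv y1) (nuv y2)) => [le|/ltW le]; [exists y1 | exists y2].
have qE : q.[y] = s.[y] * y + q`_0.
  by rewrite {1}es !hornerD !hornerM hornerX !hornerC.
have := h2 _ yle.2; have := pq _ ty; rewrite pE ?yle.1 // qE.
by case: eqP => [-> -> |_ -> /add_vlt //]; rewrite addr0 ltxx.
Qed.

(** The value at a ghost [nu y] is the sum of the constant term and of the ghost
    of the other terms at [y]; comparing the two parts at [y] shows that this sum
    depends only on the constant term and on the value at [y]. *)
Lemma e_equiv_tangible p q :
  (forall x, x \in tangible -> p.[x] = q.[x]) -> e_equiv p q.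
Proof.
move=> pq x; have e0 := coef0_eq pq.
case: (boolP (x \in tangible)) => [/pq //|]; rewrite negbK => gx.
case: (eqVneq x 0) => [->|x0]; first by rewrite !horner_coef0.
have [y ty exy] := nu_tangible_onto x gx (elimN eqP x0).
have := pq _ ty; have [r er] := poly_tail p; have [s es] := poly_tail q.
rewrite {1 2}er {1 2}es e0 !hornerD !hornerM !hornerX !hornerC -exy.
have tailE t : t.[nu y] * nu y = nu (t.[y] * y).
  by rewrite nuM -nu_horner_nu nu_mul_nu.
rewrite !tailE; move: (r.[y] * y) (s.[y] * y) (q`_0) => A B z AB.
case: (boolP (z \in ghost)) => [/nu_id zE|tz].
  by rewrite -zE -!nuD AB.
have := AB; case: (ltgtP (nuv A) (nuv z)) => [lt|gt|e].
- rewrite [A + z]add_vlt // [nu A + z]add_vlt ?nuv_nu // => zE.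
  case: (ltgtP (nuv B) (nuv z)) => [lt'|gt'|e'].
  + by rewrite add_vlt ?nuv_nu.
  + by have := gt'; rewrite -(add_vgt gt') -zE ltxx.
  + by move: tz; rewrite zE add_veq // nu_ghost.
- rewrite [A + z]add_vgt // [nu A + z]add_vgt ?nuv_nu // => zE.
  case: (ltgtP (nuv B) (nuv z)) => [lt'|gt'|e'].
  + by move: gt; rewrite zE add_vlt // ltxx.
  + by rewrite add_vgt ?nuv_nu // zE add_vgt.
  + by move: gt; rewrite zE add_veq // nuv_nu e' ltxx.
- rewrite [A + z]add_veq // [nu A + z]add_veq ?nuv_nu // => zE.
  case: (ltgtP (nuv B) (nuv z)) => [lt'|gt'|e'].
  + by move: tz; rewrite -(add_vlt lt') -zE nu_ghost.
  + by have := gt'; rewrite -(add_vgt gt') -zE nuv_nu e ltxx.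
  + by rewrite add_veq ?nuv_nu // !nu_idem zE add_veq.
Qed.

(** The degree is the growth rate at large points, which exist because the group
    of values is not trivial. *)
Lemma nuv_eq_size p q :
  (forall x, x \in tangible -> nuv p.[x] = nuv q.[x]) -> size p = size q.
Proof.
wlog lt : p q / (size q < size p)%N => [hw|] pq.
  case: (ltngtP (size q) (size p)) => // /hw; first exact.
  by move=> h; apply/esym/h => x /pq.
have := lead_coef_eq0 p; rewrite -size_poly_eq0 -leqn0 leqNgt (leq_ltn_trans _ lt) //=.
rewrite lead_coefE; case: (size p) lt => //= d dq /negbT p0; exfalso.
have qle x : nuv 1 <= nuv x -> nuv (q.[x] * x) <= nuv (q.[1] * x ^+ d).
  move=> x1; have xmono m n : (m <= n)%N -> nuv (x ^+ m) <= nuv (x ^+ n).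
    move=> /subnK <-; rewrite exprD -[X in nuv X <= _]mul1r; apply: nuvM_le => //.
    by rewrite -(expr1n _ (n - m)); apply: nuvX_le.
  rewrite {1}horner_coef mulr_suml; apply: nuv_sum_le => i _.
  rewrite -mulrA -exprSr; apply: nuvM_le.
    by have := nuv_coef_le q i 1; rewrite expr1n mulr1.
  apply: xmono. exact: (leq_trans (ltn_ord i) dq).
have [x tx] := nuv_gt_ex hG (Order.max (nuv 1) (nuv (q.[1] * tinv p`_d))).
rewrite gt_max => /andP[x1 xq].
have x0 := tangible_neq0 tx.
have qp : nuv q.[1] < nuv (p`_d * x).
  rewrite -(nuvM_lt2r _ _ (tinv_neq0 p0)) mulrAC; apply: lt_le_trans xq _.
  by rewrite -[X in nuv X <= _]mul1r; apply: nuvM_le; rewrite // nuv_mulV.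
have := qle x (ltW x1); rewrite -(nuvM_eq (pq _ tx) (erefl (nuv x))) leNgt.
move=> /negP[].
apply: lt_le_trans (nuvM_le (nuv_coef_le p d x) (lexx _)).
by rewrite mulrAC nuvM_lt2r ?exp_neq0.
Qed.

End Nontrivial.
End PolyFunctions.

(** * Ghost intervals of the factors *)

(** A pair [(a, Some b)] stands for the closed interval from [a] to [b], and
    [(a, None)] for the half-line to the right of [a]. The lower end may be 0,
    which is below all values of tangible points: [(0, Some b)] with [b] nonzero
    is a half-line to the left, and [(0, Some 0)] contains no tangible point and
    belongs to the indeterminate. *)
Definition covers (R : supertropicalType) (J : gval R * option (gval R))
    (x : gval R) : bool :=
  (J.1 <= x) && (if J.2 is Some h then x <= h else true).

Definition thin (R : supertropicalType) (J : gval R * option (gval R)) : bool :=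
  J.2 == Some J.1.

Definition left_kind (R : supertropicalType) (J : gval R * option (gval R)) :=
  J.2 == None.

Definition right_kind (R : supertropicalType) (J : gval R * option (gval R)) :=
  [&& J.1 == nuv 0, ~~ thin J & ~~ left_kind J].

Definition quad_kind (R : supertropicalType) (J : gval R * option (gval R)) :=
  [&& J.1 != nuv 0, ~~ thin J & ~~ left_kind J].

Section Intervals.
Variable F : supertropicalSemifieldType.
Implicit Types (a b c u x y : F) (I : F * option F) (p q g h : {poly F}).

Definition nuv_itv I : gval F * option (gval F) := (nuv I.1, omap (@nuv F) I.2).

(** The monic representative (up to a ghost leading coefficient) of the factors
    that are ghosts exactly on a given interval. *)
Definition gi_poly I : {poly F} :=
  match I with
  | (a, None) => nu 1 *: 'X + a%:P
  | (a, Some b) =>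
    if a == b then 'X + a%:P else
    if a == 0 then 'X + (nu b)%:P else 'X^2 + nu b *: 'X + (a * b)%:P
  end.

Definition gi_valid I : bool :=
  match I with
  | (a, None) => a \in tangible
  | (a, Some b) => ((a == 0) || (a \in tangible)) &&
                   ((a == b) || (b \in tangible) && (nuv a < nuv b))
  end.

Definition gi_roots I : seq F :=
  match I with
  | (a, None) => [:: a]
  | (a, Some b) => if a == b then [:: a] else if a == 0 then [:: b] else [:: a; b]
  end.

Lemma add_absorb a b : b \in ghost -> nuv a <= nuv b -> a + b = b.
Proof.
move=> /nu_id gb; rewrite le_eqVlt => /predU1P[ab|/add_vlt //].
by rewrite add_veq //; move/nuvP: ab => ->.
Qed.

Lemma gi_valid_lt a b : gi_valid (a, Some b) -> a != b ->
  [/\ b \in tangible, nuv a < nuv b & (a == 0) || (a \in tangible)].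
Proof. by case/andP=> ha /orP[/eqP->|/andP[]]; rewrite ?eqxx. Qed.

(** Replacing an interval by its endpoints only turns some ghost values into
    tangible ones. *)
Lemma gi_surp I x : gi_valid I ->
  surp (gi_poly I).[x] (\prod_(a <- gi_roots I) (x + a)).
Proof.
case: I => a [b|] /= hI; last first.
  rewrite big_seq1 hornerD hornerZ hornerX hornerC.
  by apply: surpD; rewrite -?nuE; [right | left].
case: (eqVneq a b) => [_|ab].
  by rewrite big_seq1 hornerD hornerX hornerC; left.
have [tb lt _] := gi_valid_lt hI ab.
case: (eqVneq a 0) => a0.
  rewrite big_seq1 hornerD hornerX hornerC.
  by apply: surpD; [left | right].
rewrite big_cons big_seq1 !hornerD hornerXn hornerZ hornerX hornerC.
have -> : (x + a) * (x + b) = x ^+ 2 + (a + b) * x + a * b by ring.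
rewrite (add_vlt lt); apply: surpD; last by left.
apply: surpD; first by left.
by apply: surpM; [right | left].
Qed.

Lemma gi_poly_ghost I x : gi_valid I -> x \in tangible ->
  ((gi_poly I).[x] \in ghost) = covers (nuv_itv I) (nuv x).
Proof.
case: I => a [b|] /= hI tx; rewrite /covers /=; have x0 := tangible_neq0 tx.
  case: (eqVneq a b) => [<-|ab].
    rewrite hornerD hornerX hornerC.
    case: (ltgtP (nuv a) (nuv x)) => [lt|gt|e] /=.
    - by rewrite add_vgt // (negbTE tx).
    - rewrite add_vlt //; case/andP: hI.
      by rewrite (negbTE (lt_v_neq0 gt)) /= => /negbTE->.
    - by rewrite add_veq ?e // nu_ghost.
  have [tb lt ta] := gi_valid_lt hI ab.
  case: (eqVneq a 0) ta => [-> _|a0 /= ta].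
    rewrite nuv0_le /= hornerD hornerX hornerC.
    case: (leP (nuv x) (nuv b)) => [le|gt].
      by rewrite add_absorb ?nuv_nu ?nu_ghost.
    by rewrite add_vgt ?nuv_nu // (negbTE tx).
  rewrite !hornerD hornerXn hornerZ hornerX hornerC.
  have b0 := tangible_neq0 tb.
  case: (leP (nuv a) (nuv x)) => [ax|xa] /=; last first.
    rewrite add_vlt; first by rewrite (negbTE (tangibleM _ _ ta tb)).
    rewrite nuvD gt_max expr2 nuvM_lt ?(ltW (lt_trans xa lt)) //=.
    by rewrite mulrC nuvM_lt ?nuv_nu.
  case: (leP (nuv x) (nuv b)) => [xb|bx].
    have gB : nu b * x \in ghost by rewrite ghostM ?nu_ghost.
    rewrite [x ^+ 2 + _]add_absorb //; last first.
      by rewrite expr2; apply: nuvM_le; rewrite ?nuv_nu.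
    rewrite addrC add_absorb //.
    by rewrite mulrC; apply: nuvM_le; rewrite ?nuv_nu.
  rewrite -addrA add_vgt; first by rewrite (negbTE (tangibleX _ tx)).
  rewrite expr2 nuvD gt_max nuvM_lt ?nuv_nu //=.
  by apply: nuvM_lt (lt_trans lt bx) (ltW bx) _.
rewrite andbT hornerD hornerZ hornerX hornerC -nuE.
case: (leP (nuv a) (nuv x)) => [le|gt].
  by rewrite addrC add_absorb ?nuv_nu ?nu_ghost.
by rewrite add_vlt ?nuv_nu // (negbTE hI).
Qed.

Lemma size_linear a b : b != 0 -> size (b%:P * 'X + a%:P) = 2%N.
Proof.
by move=> b0; rewrite size_MXaddC size_polyC polyC_eq0 (negbTE b0).
Qed.

Lemma size_quad a b c :
  c != 0 -> size ((c%:P * 'X + b%:P) * 'X + a%:P) = 3%N.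
Proof.
move=> c0; rewrite size_MXaddC size_linear //.
by rewrite -size_poly_eq0 size_linear.
Qed.

Lemma size_gi_poly I : gi_valid I ->
  size (gi_poly I) = (quad_kind (nuv_itv I) + 2)%N.
Proof.
have n1 : nu 1 != 0 :> F by rewrite nu_neq0 // tangible_neq0 ?tangible1.
case: I => a [b|] hI; rewrite /quad_kind /thin /left_kind /=; last first.
  by rewrite andbF -mul_polyC size_linear.
case: (eqVneq a b) => [->|ab].
  by rewrite eqxx andbF size_XaddC.
have [tb lt ta] := gi_valid_lt hI ab.
have -> : (Some (nuv b) == Some (nuv a)) = false.
  by rewrite (inj_eq (@Some_inj _)) gt_eqF.
rewrite nuv_eq0; case: (eqVneq a 0) => a0 /=; first by rewrite size_XaddC.
apply: etrans (size_quad (a * b) (nu b) (tangible_neq0 tangible1)).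
by rewrite mul1r mulrDl mul_polyC expr2.
Qed.

End Intervals.

(** * Irreducibility *)
Section Irreducibility.
Variable F : supertropicalSemifieldType.
Hypothesis hF : divisibly_closed F.
Hypothesis hG : exists2 a : F, a \in tangible & nu a <> nu 1.
Implicit Types (a b c u x y : F) (I : F * option F) (p q g h : {poly F}).

Lemma e_equiv_size p q : e_equiv p q -> size p = size q.
Proof. by move=> pq; apply: (nuv_eq_size hG) => x _; rewrite pq. Qed.

Lemma e_constant_size p : e_constant p -> (size p <= 1)%N.
Proof. by case=> c /e_equiv_size ->; apply: size_polyC_leq1. Qed.

Lemma nonconstant_size p : ~ e_constant p -> (1 < size p)%N.
Proof.
move=> np; rewrite ltnNge; apply/negP => /size1_polyC p1.
by apply: np; exists p`_0 => x; rewrite {1}p1.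
Qed.

Lemma e_factor_size p g h : e_equiv p (g * h) -> ~ e_constant g ->
  ~ e_constant h -> (size p).+1 = (size g + size h)%N.
Proof.
move=> /e_equiv_size-> /nonconstant_size g1 /nonconstant_size h1.
rewrite poly_size_mul ?prednK -?size_poly_gt0 ?(ltnW g1) ?(ltnW h1) //.
by rewrite addn_gt0 (ltnW g1).
Qed.

Lemma linear_irreducible p : size p = 2%N -> e_irreducible p.
Proof.
move=> p2 [g [h [e ng nh]]].
have := e_factor_size e ng nh.
have := nonconstant_size ng; have := nonconstant_size nh.
by rewrite p2; lia.
Qed.

Lemma horner_size2 g x : size g = 2%N -> g.[x] = g`_1 * x + g`_0.
Proof.
move=> sg; rewrite horner_coef sg !big_ord_recl big_ord0 /=.
by rewrite addr0 mulr1 expr1 addrC.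
Qed.

Lemma linear_tangible g x : size g = 2%N -> x \in tangible ->
  g`_1 \in tangible -> g`_0 \in tangible ->
  nuv x != nuv (g`_0 * tinv g`_1) -> g.[x] \in tangible.
Proof.
move=> sg tx t1 t0; rewrite -(nuvM_eq2l _ _ (tangible_neq0 t1)) horner_size2 //.
rewrite mulrCA mulV // mulr1; case: ltgtP => // [lt|gt] _.
  by rewrite add_vlt.
by rewrite add_vgt // tangibleM.
Qed.

Lemma lead_tangible g y : size g = 2%N ->
  (forall x, x \in tangible -> nuv y < nuv x -> g.[x] \in tangible) ->
  g`_1 \in tangible.
Proof.
move=> sg gt; have g1 : g`_1 != 0.
  by have := lead_coef_eq0 g; rewrite lead_coefE sg /= => ->;
    rewrite -size_poly_gt0 sg.
have [x tx] := nuv_gt_ex hG (Order.max (nuv y) (nuv (g`_0 * tinv g`_1))).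
rewrite gt_max => /andP[/(gt _ tx)]; rewrite -(nuvM_lt2l _ _ g1) mulrCA.
rewrite horner_size2 // => tg lt; move: tg; rewrite add_vgt.
  by apply: contra => /ghostM; apply.
apply: le_lt_trans lt; rewrite -[X in nuv X <= _]mulr1.
by apply: nuvM_le; rewrite // nuv_mulV.
Qed.

(** Two linear factors would be tangible on both sides of the interval, hence
    have tangible coefficients, hence be ghosts at one value each. Another point
    of the interval contradicts the ghost value of the quadratic. *)
Lemma quad_irreducible I : gi_valid I -> quad_kind (nuv_itv I) ->
  e_irreducible (gi_poly I).
Proof.
move=> hI qI [g [h [e ng nh]]].
have := e_factor_size e ng nh; rewrite size_gi_poly // qI.
have := nonconstant_size ng; have := nonconstant_size nh.
move=> h1 g1 sgh; have {}sgh : 4 = (size g + size h)%N by exact: sgh.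
have [sg sh] : size g = 2%N /\ size h = 2%N.
  by move: h1 g1 sgh; lia.
have tM x : (gi_poly I).[x] \in tangible ->
    g.[x] \in tangible /\ h.[x] \in tangible.
  rewrite e hornerM => t; split; apply: contra t => gh; first exact: ghostM.
  exact: ghostMl.
have stat x (tx : x \in tangible) := gi_poly_ghost hI tx.
case: I hI qI e tM stat => a [b|]; last by rewrite /quad_kind andbF.
rewrite /quad_kind /thin /left_kind /= nuv_eq0 andbT => hI /andP[a0 ab] e tM stat.
have {}ab : a != b by apply: contraNneq ab => ->.
have [tb lt] := gi_valid_lt hI ab; rewrite (negbTE a0) /= => ta.
rewrite (negbTE ab) (negbTE a0) in e tM stat.
have [g0 h0] : g`_0 \in tangible /\ h`_0 \in tangible.
  have := tM 0; rewrite !horner_coef0; apply.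
  rewrite !coefD coefXn coefZ coefX coefC /= mulr0 !add0r.
  exact: tangibleM.
have big x : x \in tangible -> nuv b < nuv x -> g.[x] \in tangible /\ h.[x] \in tangible.
  move=> tx bx; apply: tM; rewrite tangibleN stat // /covers /=.
  by rewrite [nuv x <= _]leNgt bx andbF.
have g1t : g`_1 \in tangible by apply: (lead_tangible (y := b)) => // x tx /(big _ tx)[].
have h1t : h`_1 \in tangible by apply: (lead_tangible (y := b)) => // x tx /(big _ tx)[].
have [x [tx ax xb xE]] :=
  just_after hF hG [:: nuv (g`_0 * tinv g`_1); nuv (h`_0 * tinv h`_1)] lt.
have xne r : r \in [:: nuv (g`_0 * tinv g`_1); nuv (h`_0 * tinv h`_1)] -> nuv x != r.
  move=> /xE; case: (ltP (nuv a) r) => [_ /(_ isT)/lt_eqF->//|le _].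
  by rewrite gt_eqF // (le_lt_trans le ax).
have := stat _ tx; rewrite /covers /= (ltW ax) (ltW xb) e hornerM.
apply/negP; apply: tangibleM; apply: linear_tangible => //; apply: xne;
  by rewrite !inE eqxx ?orbT.
Qed.

End Irreducibility.

(** * The upper boundary of the hull *)
Section Hull.
Variable F : supertropicalSemifieldType.
Implicit Types (a b c u x y : F) (f p q g h : {poly F}).

Lemma ghost_leP a b : a \in ghost -> b \in ghost ->
  ghost_le a b <-> nuv a <= nuv b.
Proof.
by move=> ga gb; rewrite nuv_le !nu_id // /ghost_le; split=> [/eqP|/eqP].
Qed.

Lemma nu_gtP a b : nu_gt a b <-> nuv b < nuv a.
Proof.
rewrite lt_neqAle /nu_gt /ghost_le nuv_le; split=> [[/eqP -> ne]|/andP[ne /eqP ->]].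
  by rewrite andbT; apply/eqP => /nuvP/esym.
by split=> // /nuvP e; rewrite e eqxx in ne.
Qed.

Lemma essential_at f k x : nuv 0 < nuv (f`_k * x ^+ k) ->
  (forall i, i != k -> nuv (f`_i * x ^+ i) < nuv (f`_k * x ^+ k)) -> essential f k.
Proof.
move=> gt0 gt; exists x; apply/nu_gtP.
have mE i : (monomial f i).[x] = f`_i * x ^+ i by rewrite hornerZ hornerXn.
rewrite mE /other_monomials horner_sum.
elim/big_ind: _ => // [y z ylt zlt|i /gt]; first by rewrite nuvD gt_max ylt.
by rewrite mE.
Qed.

Lemma nuv_prod_le (I : Type) (s : seq I) (h1 h2 : I -> F) :
  (forall i, nuv (h1 i) <= nuv (h2 i)) ->
  nuv (\prod_(i <- s) h1 i) <= nuv (\prod_(i <- s) h2 i).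
Proof.
by move=> le; elim/big_ind2: _ => // *; apply: nuvM_le.
Qed.

(** A supporting line of the hull, in multiplicative form: its slope is the
    inverse of [x], and it passes through the point of abscissa [k] and ordinate
    [y]. *)
Definition supports f x k y := forall i, nuv (f`_i * x ^+ i) <= nuv (y * x ^+ k).

(** A weighted mean of points below a line is below the line. *)
Lemma hull_bound f x k y c : x != 0 -> supports f x k c ->
  hull f (k%:R, y) -> nuv y <= nuv c.
Proof.
move=> x0 sup [/= gy y0 [n [N0 nz /eqP]]].
set N := (\sum_i n i)%N in N0 *.
rewrite -natr_sum -natrM eqr_nat => /eqP Nk yN.
rewrite -(nuvX_le2 _ _ N0) -(nuvM_le2r _ _ (exp_neq0 (k * N) x0)).
have -> : c ^+ N * x ^+ (k * N) = \prod_i (c * x ^+ k) ^+ n i.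
  by rewrite prodrXr exprMn exprM.
rewrite yN mulnC Nk -prodrXr -big_split /=; apply: nuv_prod_le => i.
rewrite mulnC exprM -exprMn; apply: nuvX_le; apply: le_trans (sup i).
by apply: nuvM_le; rewrite ?nuv_nu.
Qed.

Lemma hull_coef f k : f`_k != 0 -> hull f (coef_point f k).
Proof.
move=> fk; have kf : (k < size f)%N.
  by rewrite ltnNge; apply: contra fk => /(nth_default _) ->.
split; rewrite /= ?nu_ghost //; first exact/eqP/nu_neq0.
pose n (i : 'I_(size f)) := nat_of_bool (i == k :> nat).
have sumn (w : nat -> nat) : (\sum_i n i * w i = w k)%N.
  rewrite (bigD1 (Ordinal kf)) //= /n eqxx mul1n big1 ?addn0 // => i.
  by rewrite -val_eqE /= => /negbTE->.
have N1 : (\sum_i n i = 1)%N.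
  by rewrite -(sumn (fun=> 1%N)); apply: eq_bigr => i _; rewrite muln1.
exists n; rewrite N1; split=> //.
- move=> i f0; rewrite /n; case: eqP => // ik.
  by rewrite -ik f0 eqxx in fk.
- by rewrite mul1r -natr_sum (sumn id).
- rewrite expr1 (bigD1 (Ordinal kf)) //= /n eqxx expr1 big1 ?mulr1 // => i.
  by rewrite -val_eqE /= => /negbTE->; rewrite expr0.
Qed.

(** If a line of slope the inverse of [x] passes through the points of abscissas
    [i] and [j], then it meets the hull at [i.+1], where the weights of [i] and
    [j] are [j - i.+1] and 1. *)
Lemma hull_chord f i j x y : (i < j)%N -> x != 0 -> f`_i != 0 -> f`_j != 0 ->
  y \in ghost -> nuv (y * x) = nuv f`_i -> nuv (f`_j * x ^+ j) = nuv (f`_i * x ^+ i) ->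
  hull f ((i.+1)%:R, y).
Proof.
move=> ij x0 fi fj gy yx fjx.
have kf k : f`_k != 0 -> (k < size f)%N.
  by rewrite ltnNge => fk; apply: contra fk => /(nth_default _) ->.
have y0 : y <> 0.
  move=> y0; move: yx; rewrite y0 mul0r => /esym/eqP.
  by rewrite nuv_eq0 (negbTE fi).
split=> //=.
pose n (k : 'I_(size f)) := ((k == i :> nat) * (j - i.+1) + (k == j :> nat))%N.
have neij : (i == j) = false by rewrite ltn_eqF.
have sumn (w : nat -> nat) : (\sum_k n k * w k = (j - i.+1) * w i + w j)%N.
  rewrite (bigD1 (Ordinal (kf _ fi))) //= (bigD1 (Ordinal (kf _ fj))) /=; last first.
    by rewrite -val_eqE /= eq_sym neij.
  rewrite /n !eqxx neij eq_sym neij big1 => [|k /andP[]]; first by lia.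
  by rewrite -!val_eqE /= => /negbTE-> /negbTE->.
have NE : (\sum_k n k = j - i)%N.
  transitivity (\sum_k n k * 1)%N; first by apply: eq_bigr => k _; rewrite muln1.
  by rewrite (sumn (fun=> 1%N)); lia.
exists n; rewrite NE; split; first by rewrite subn_gt0.
- move=> k f0; rewrite /n; case: eqP => [ki|_]; first by rewrite -ki f0 eqxx in fi.
  by case: eqP => // kj; rewrite -kj f0 eqxx in fj.
- by rewrite -natr_sum -natrM (sumn id); congr (_%:R); nia.
apply: nuv_inj_ghost.
- case: (j - i)%N (subn_gt0 i j) => [|m _]; first by rewrite ij.
  by rewrite exprS ghostM.
- rewrite (bigD1 (Ordinal (kf _ fj))) //= ghostM //.
  by rewrite /n eqxx eq_sym neij expr1 nu_ghost.
rewrite (bigD1 (Ordinal (kf _ fi))) //= (bigD1 (Ordinal (kf _ fj))) /=; last first.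
  by rewrite -val_eqE /= eq_sym neij.
rewrite /n !eqxx neij eq_sym neij big1 => [|k /andP[]]; last first.
  by rewrite -!val_eqE /= => /negbTE-> /negbTE->.
rewrite mul0n mul1n addn0 add0n expr1 mulr1.
apply/eqP; rewrite -(nuvM_eq2r _ _ (exp_neq0 (j - i) x0)) -exprMn.
have -> : (j - i = (j - i.+1) + 1)%N by lia.
rewrite (exprD (y * x)) -mulrA; apply/eqP/nuvM_eq.
  by apply: nuvX_eq; rewrite nuv_nu.
rewrite expr1 addn1 -subSn // subSS yx.
apply/eqP; rewrite -(nuvM_eq2r _ _ (exp_neq0 i x0)) -fjx -mulrA -exprD subnK 1?ltnW //.
by apply/eqP/nuvM_eq; rewrite ?nuv_nu.
Qed.

Lemma supported_boundary f x k y : x != 0 -> y \in ghost -> supports f x k y ->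
  hull f (k%:R, y) -> upper_boundary f (k%:R, y).
Proof.
move=> x0 gy sup hy; split=> // z hz /=; apply/ghost_leP => //; first by case: hz.
exact: hull_bound x0 sup hz.
Qed.

Lemma supported_coef f x k : x != 0 -> f`_k != 0 -> supports f x k f`_k ->
  upper_boundary f (coef_point f k).
Proof.
move=> x0 fk sup; apply: (supported_boundary x0); rewrite ?nu_ghost //.
  by move=> i; rewrite (nuvM_eq (nuv_nu _) (erefl _)).
exact: hull_coef.
Qed.

End Hull.

(** * Full polynomials are log-concave *)
Section Full.
Variable F : supertropicalSemifieldType.
Hypothesis hF : divisibly_closed F.
Implicit Types (a b c u x y : F) (f p q g h : {poly F}).

(** One step of gift wrapping. Turn the supporting line at [i] until it meets a
    point further to the right; its point of abscissa [i.+1] is on the boundary,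
    so fullness provides a monomial there. *)
Lemma full_step f i : full f -> (i.+1 < size f)%N -> f`_i != 0 ->
  (forall m, (m < i)%N -> f`_m = 0) \/
    (exists2 x, x != 0 & supports f x i f`_i) ->
  exists x, [/\ x != 0, supports f x i f`_i, f`_i.+1 != 0 &
    nuv (f`_i.+1 * x) = nuv f`_i].
Proof.
move=> ff isz fi low.
(* [X j] is the point at which the monomials [i] and [j] have equal values. *)
have /choice [X HX] : forall j, exists y, (i < j)%N ->
    y ^+ (j - i) = f`_i * tinv f`_j.
  move=> j; case: (ltnP i j) => [ij|_]; last by exists 0.
  have ji : (0 < j - i)%N by rewrite subn_gt0.
  by have [y <-] := nth_root_exists hF (f`_i * tinv f`_j) ji; exists y.
have X0 j : (i < j)%N -> f`_j != 0 -> X j != 0.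
  move=> ij fj; apply: contraTneq (mul_neq0 fi (tinv_neq0 fj)) => xj.
  by rewrite -(HX _ ij) xj expr0n subn_eq0 leqNgt ij eqxx.
have key j x : (i < j)%N -> f`_j != 0 -> x != 0 ->
    (nuv (f`_j * x ^+ j) <= nuv (f`_i * x ^+ i)) = (nuv x <= nuv (X j)).
  move=> ij fj x0; rewrite -(subnK (ltnW ij)) exprD mulrA.
  rewrite (nuvM_le2r _ _ (exp_neq0 i x0)) subnK; last exact: ltnW.
  rewrite -(nuvX_le2 x _ (n := j - i)) ?subn_gt0 // HX //.
  rewrite -[in RHS](nuvM_le2l _ _ fj) mulrCA.
  by congr (_ <= _); rewrite -[f`_i in LHS]mulr1; apply: nuvM_eq; rewrite // nuv_mulV.
pose P (j : 'I_(size f)) := (i < j)%N && (f`_j != 0).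
have lastsz : ((size f).-1 < size f)%N by rewrite prednK // (leq_trans _ isz).
have P0 : P (Ordinal lastsz).
  rewrite /P /= -lead_coefE lead_coef_eq0 -size_poly_gt0 (ltn_trans _ isz) // andbT.
  by rewrite -ltnS prednK // (ltn_trans _ isz).
(* The smallest [X j] corresponds to the first contact with a point on the
   right. *)
have [j /andP[ij fj] jmin] := Order.TotalTheory.arg_minP (fun j : 'I__ => nuv (X j)) P0.
have x0 := X0 _ ij fj.
have sup : supports f (X j) i f`_i.
  move=> m; case: (ltngtP m i) => [mi|im|->//]; last first.
    case: (eqVneq f`_m 0) => [->|fm]; first by rewrite mul0r nuv0_le.
    have msz : (m < size f)%N.
      by rewrite ltnNge; apply: contra fm => /(nth_default _) ->.
    by rewrite key // (jmin (Ordinal msz)) // /P /= im.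
  case: low => [/(_ _ mi)->|[x xn0 sx]]; first by rewrite mul0r nuv0_le.
  have xX : nuv x <= nuv (X j) by rewrite -key.
  have := sx m; rewrite -(subnK (ltnW mi)) !exprD !mulrA.
  rewrite (nuvM_le2r _ _ (exp_neq0 m xn0)) (nuvM_le2r _ _ (exp_neq0 m x0)).
  rewrite subnK 1?ltnW // => le; apply: le_trans le _; apply: nuvM_le => //.
  exact: nuvX_le.
pose y := nu (f`_i * tinv (X j)).
have yX : nuv (y * X j) = nuv f`_i.
  rewrite (nuvM_eq (nuv_nu _) (erefl _)) -mulrA [tinv _ * _]mulrC.
  by rewrite -[Z in _ = nuv Z]mulr1; apply: nuvM_eq; rewrite // nuv_mulV.
have bd : upper_boundary f (i.+1%:R, y).
  apply: (supported_boundary x0); rewrite ?nu_ghost //.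
    by move=> m; rewrite exprS mulrA (nuvM_eq yX (erefl _)).
  apply: (hull_chord ij x0) => //; first exact: nu_ghost.
  apply/eqP; rewrite eq_le sup /=.
  have -> : X j ^+ j = X j ^+ (j - i) * X j ^+ i by rewrite -exprD subnK // ltnW.
  rewrite mulrA (nuvM_le2r _ _ (exp_neq0 i x0)) HX // mulrCA.
  by rewrite -[Z in nuv Z <= _]mulr1; apply: nuvM_le; rewrite // nuv_mulV.
have [/eqP f1 yE _] := ff.1 _ _ bd.
by exists (X j); split=> //; rewrite -yX yE; apply: nuvM_eq; rewrite ?nuv_nu.
Qed.

Lemma supports_step f x i : x != 0 -> nuv (f`_i.+1 * x) = nuv f`_i ->
  supports f x i f`_i -> supports f x i.+1 f`_i.+1.
Proof. by move=> x0 e sup m; rewrite exprS mulrA (nuvM_eq e (erefl _)). Qed.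

Lemma full_supports f l i : full f -> (forall m, (m < l)%N -> f`_m = 0) ->
  f`_l != 0 -> (l <= i)%N -> (i.+1 < size f)%N ->
  f`_i != 0 /\ exists x, [/\ x != 0, supports f x i f`_i, f`_i.+1 != 0 &
    nuv (f`_i.+1 * x) = nuv f`_i].
Proof.
move=> ff low fl /subnKC <-; elim: (i - l)%N => [|n IH] sz.
  by rewrite addn0 in sz *; split=> //; apply: full_step => //; left.
rewrite addnS in sz *.
have [fi [x [x0 sup f1 e]]] := IH (ltnW sz).
split=> //; apply: full_step => //; right; exists x => //.
exact: supports_step.
Qed.

Lemma full_coef_neq0 f l i : full f -> (forall m, (m < l)%N -> f`_m = 0) ->
  f`_l != 0 -> (l <= i)%N -> (i < size f)%N -> f`_i != 0.
Proof.
move=> ff low fl; rewrite leq_eqVlt => /predU1P[<- //|].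
case: i => // i li isz.
by have [_ [x []]] := full_supports ff low fl li isz.
Qed.

(** In the case of equality, the points [i], [i.+1] and [i.+2] are on one
    supporting line, so the middle one is quasi-essential. *)
Lemma full_concave f l i : full f -> (forall m, (m < l)%N -> f`_m = 0) ->
  f`_l != 0 -> (l <= i)%N -> (i.+2 < size f)%N ->
  nuv (f`_i * f`_i.+2) <= nuv (f`_i.+1 * f`_i.+1) /\
  (nuv (f`_i * f`_i.+2) = nuv (f`_i.+1 * f`_i.+1) -> f`_i.+1 \in ghost).
Proof.
move=> ff low fl li isz.
have [fi [x [x0 sup f1 e]]] := full_supports ff low fl li (ltnW isz).
have f2 := full_coef_neq0 ff low fl (leqW (leqW li)) isz.
have sup1 := supports_step x0 e sup.
have := sup1 i.+2; rewrite exprS mulrA (nuvM_le2r _ _ (exp_neq0 _ x0)) => le2.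
have fE : nuv (f`_i * f`_i.+2) = nuv (f`_i.+1 * (f`_i.+2 * x)).
  by rewrite -(nuvM_eq e (erefl _)) -mulrA [x * _]mulrC.
rewrite fE; split=> [|/eqP]; first exact: nuvM_le.
rewrite (nuvM_eq2l _ _ f1) => /eqP e2.
have bd j : f`_j != 0 -> supports f x j f`_j -> upper_boundary f (coef_point f j).
  by move=> *; apply: (supported_coef x0).
apply: ff.2; split; [exact/eqP | exact: bd | case=> _ vx].
apply: (vx (coef_point f i) (coef_point f i.+2)).
- exact: bd.
- by apply: bd => //; apply: supports_step.
split; first by case=> /eqP; rewrite eqr_nat => /eqP; lia.
exists 1%N, 1%N; split=> //=.
  by rewrite !mul1r -natrM -natrD; congr (_%:R); lia.
by rewrite expr1 expr1 expr2 -!nuM; apply/nuvP; rewrite fE; apply: nuvM_eq.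
Qed.

End Full.

(** * Quadratic polynomials with three essential monomials *)
Section Quadratics.
Variable F : supertropicalSemifieldType.
Hypothesis hF : divisibly_closed F.
Hypothesis hG : exists2 a : F, a \in tangible & nu a <> nu 1.
Implicit Types (a b c u x y : F) (f p q g h : {poly F}).

Lemma hull_abscissa f P : hull f P -> 0 <= P.1 <= ((size f).-1)%:R.
Proof.
case=> _ _ [n [N0 _ e _]]; set N := (\sum_i n i)%N in N0 e.
have N0r : 0 < N%:R :> rat by rewrite ltr0n.
rewrite -(ler_pM2l N0r) -[_ <= _%:R](ler_pM2l N0r) mulr0 e -natr_sum ler0n /=.
rewrite -natrM ler_nat big_distrl /=; apply: leq_sum => i _.
by rewrite leq_mul2l -ltnS prednK ?ltn_ord ?orbT // (leq_ltn_trans _ (ltn_ord i)).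
Qed.

Lemma boundary_inj f P Q : upper_boundary f P -> upper_boundary f Q ->
  P.1 = Q.1 -> P = Q.
Proof.
case: P Q => [i y] [j z] [hP bP] [hQ bQ] /= e; rewrite -e in hQ bQ *.
congr (_, _); have := bP _ hQ; have := bQ _ hP.
by rewrite /= /ghost_le addrC => -> .
Qed.

(** A mean of two abscissas is extreme only if both are. *)
Lemma end_vertex f k : upper_boundary f (coef_point f k) ->
  k = 0%N \/ k = (size f).-1 -> vertex f (coef_point f k).
Proof.
move=> bk kend; split=> // Q1 Q2 b1 b2 [ne [n1 [n2 [n1p n2p /= e _]]]].
have /andP[l1 r1] := hull_abscissa b1.1; have /andP[l2 r2] := hull_abscissa b2.1.
have n1r : 0 < n1%:R :> rat by rewrite ltr0n.
have n2r : 0 < n2%:R :> rat by rewrite ltr0n.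
rewrite natrD in e.
apply: ne; apply: (boundary_inj b1 b2).
have sq m (t : rat) : 0 < m%:R :> rat -> 0 <= t -> 0 <= m%:R * t.
  by move=> m0 t0; rewrite mulr_ge0 // ltW.
case: kend => ek; rewrite ek in e.
  have [e1 e2] : n1%:R * Q1.1 = 0 /\ n2%:R * Q2.1 = 0.
    have := sq _ _ n1r l1; have := sq _ _ n2r l2; move: e; rewrite mulr0; lra.
  move/eqP: e1; move/eqP: e2; rewrite !mulf_eq0 (gt_eqF n1r) (gt_eqF n2r) /=.
  by move=> /eqP -> /eqP ->.
have [e1 e2] : n1%:R * ((size f).-1%:R - Q1.1) = 0 /\
    n2%:R * ((size f).-1%:R - Q2.1) = 0.
  have := sq _ ((size f).-1%:R - Q1.1) n1r; rewrite subr_ge0 => /(_ r1).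
  have := sq _ ((size f).-1%:R - Q2.1) n2r; rewrite subr_ge0 => /(_ r2).
  by move: e; rewrite !mulrBr mulrDl; lra.
move/eqP: e1; move/eqP: e2; rewrite !mulf_eq0 (gt_eqF n1r) (gt_eqF n2r) /= !subr_eq0.
by move=> /eqP <- /eqP <-.
Qed.

Section Strict.
Variable p : {poly F}.
Hypotheses (p0 : p`_0 != 0) (p1 : p`_1 != 0) (p2 : p`_2 != 0).
Hypotheses (sp : size p = 3%N) (strict : nuv (p`_0 * p`_2) < nuv (p`_1 * p`_1)).

(** The points to choose lie on either side of, and between, the two corner
    roots [r] and [s], which are distinct by log-concavity. *)
Lemma quad_dominant k : (k < 3)%N -> exists x, [/\ x != 0,
  nuv 0 < nuv (p`_k * x ^+ k) &
  forall i, i != k -> nuv (p`_i * x ^+ i) < nuv (p`_k * x ^+ k)].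
Proof.
pose r := p`_0 * tinv p`_1; pose s := p`_1 * tinv p`_2.
have r0 : r != 0 by rewrite mul_neq0 ?tinv_neq0.
have p0E : nuv p`_0 = nuv (p`_1 * r).
  by rewrite mulrCA -[X in nuv X = _]mulr1; apply: nuvM_eq; rewrite // nuv_mulV.
have p1E : nuv p`_1 = nuv (p`_2 * s).
  by rewrite mulrCA -[X in nuv X = _]mulr1; apply: nuvM_eq; rewrite // nuv_mulV.
have rs : nuv r < nuv s.
  rewrite -(nuvM_lt2l _ _ p1) -p0E -(nuvM_lt2l _ _ p2) mulrC.
  by rewrite [p`_2 * _]mulrCA (nuvM_eq (erefl _) (esym p1E)).
have c01 x : (nuv p`_0 < nuv (p`_1 * x)) = (nuv r < nuv x) by rewrite p0E nuvM_lt2l.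
have c10 x : (nuv (p`_1 * x) < nuv p`_0) = (nuv x < nuv r) by rewrite p0E nuvM_lt2l.
have c12 x : x != 0 -> (nuv (p`_1 * x) < nuv (p`_2 * x ^+ 2)) = (nuv s < nuv x).
  by move=> x0; rewrite expr2 mulrA nuvM_lt2r // p1E nuvM_lt2l.
have c21 x : x != 0 -> (nuv (p`_2 * x ^+ 2) < nuv (p`_1 * x)) = (nuv x < nuv s).
  by move=> x0; rewrite expr2 mulrA nuvM_lt2r // p1E nuvM_lt2l.
have coords (Q : nat -> Prop) : Q 0%N -> Q 1%N -> Q 2%N ->
    (forall i, p`_i = 0 -> Q i) -> forall i, Q i.
  by move=> ? ? ? h [|[|[|i]]] //; apply: h; rewrite nth_default ?sp.
case: k => [|[|[|//]]] _.
- have [x tx xr] := nuv_lt_ex hG (g := nuv r) ltac:(by rewrite nuv_gt0).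
  have x0 := tangible_neq0 tx; exists x; rewrite mulr1 nuv_gt0; split=> //.
  have lt1 : nuv (p`_1 * x) < nuv p`_0 by rewrite c10.
  apply: coords => // [_|i -> _].
    by apply: lt_trans lt1; rewrite c21 // (lt_trans xr).
  by rewrite mul0r nuv_gt0.
- have [x [tx rx xs]] := nuv_between hF hG rs.
  have x0 := tangible_neq0 tx; exists x; rewrite expr1 nuv_gt0 mul_neq0 //.
  split=> //; apply: coords => // [_|_|i -> _].
  + by rewrite mulr1 c01.
  + by rewrite c21.
  + by rewrite mul0r nuv_gt0 mul_neq0.
- have [x tx sx] := nuv_gt_ex hG (nuv s).
  have x0 := tangible_neq0 tx; exists x; rewrite nuv_gt0 mul_neq0 ?exp_neq0 //.
  have lt1 : nuv (p`_1 * x) < nuv (p`_2 * x ^+ 2) by rewrite c12.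
  split=> //; apply: coords => // [_|i -> _].
  + by rewrite mulr1; apply: lt_trans lt1; rewrite c01 (lt_trans rs).
  + by rewrite mul0r nuv_gt0 mul_neq0 ?exp_neq0.
Qed.

Lemma quad_essential k : (k < 3)%N -> essential p k.
Proof. by move=> /quad_dominant[x [x0 gt0 gt]]; apply: essential_at gt. Qed.

Lemma quad_full : p`_1 \in ghost -> full p.
Proof.
move=> g1; have pk k : p`_k != 0 -> (k < 3)%N.
  by rewrite -sp ltnNge => fk; apply: contra fk => /(nth_default _) ->.
have pk' k : (k < 3)%N -> p`_k != 0 by case: k => [|[|[|]]].
split=> [k y bd|k [/eqP/pk k3 bd nv]]; last first.
  case: k k3 bd nv => [|[|[|//]]] // _ bd []; apply: end_vertex => //.
    by left.
  by right; rewrite sp.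
have k3 : (k < 3)%N.
  by have := hull_abscissa bd.1; rewrite sp /= ler_nat => /andP[].
split; [exact/eqP/pk' | | by left; apply: quad_essential].
have [x [x0 _ gt]] := quad_dominant k3.
have sup : supports p x k p`_k.
  by move=> i; case: (eqVneq i k) => [->|/gt/ltW].
have bk := supported_coef x0 (pk' _ k3) sup.
by have [] := boundary_inj bd bk erefl.
Qed.

End Strict.
End Quadratics.

(** * The interval of an irreducible factor *)
Section Factors.
Variable F : supertropicalSemifieldType.
Hypothesis hF : divisibly_closed F.
Hypothesis hG : exists2 a : F, a \in tangible & nu a <> nu 1.
Implicit Types (a b c u x y : F) (I : F * option F) (f p q g h : {poly F}).

(** The last three clauses carry the information that is needed to count the
    factors of each kind by means of their intervals. *)
Definition interval_of g I : Prop := exists2 u, u \in tangible &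
  [/\ gi_valid I, (forall x, g.[x] = u * (gi_poly I).[x]),
      (left_kind (nuv_itv I) -> linear_left_ghost g),
      (right_kind (nuv_itv I) -> linear_right_ghost g) &
      (quad_kind (nuv_itv I) -> ghost_quadratic g)].

Lemma gi_valid_kinds I : gi_valid I ->
  [/\ left_kind (nuv_itv I) -> exists2 a, a \in tangible & I = (a, None),
      right_kind (nuv_itv I) -> exists2 b, b \in tangible & I = (0, Some b) &
      quad_kind (nuv_itv I) -> exists a b,
        [/\ a \in tangible, b \in tangible, nuv a < nuv b & I = (a, Some b)]].
Proof.
case: I => a [b|] hI; rewrite /left_kind /right_kind /quad_kind /thin /=.
  split=> // /and3P[]; rewrite nuv_eq0 => a0 ab _.
    have {}ab : a != b by apply: contraNneq ab => ->.
    have [tb lt _] := gi_valid_lt hI ab; exists b => //.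
    by rewrite (eqP a0).
  have {}ab : a != b by apply: contraNneq ab => ->.
  have [tb lt] := gi_valid_lt hI ab; rewrite (negbTE a0) /= => ta.
  by exists a, b.
by split=> [_||]; [exists a| rewrite !andbF | rewrite !andbF].
Qed.

Lemma horner_size3 g x : size g = 3%N ->
  g.[x] = g`_2 * x ^+ 2 + g`_1 * x + g`_0.
Proof.
move=> sg; rewrite horner_coef sg !big_ord_recl big_ord0 /=.
by rewrite addr0 mulr1 expr1 addrC [g`_1 * x + _]addrC.
Qed.

(** A full quadratic with equality in the log-concavity is the product of two
    linear polynomials whose roots have the same value, so irreducibility makes
    the inequality strict. *)
Lemma quadratic_interval g : e_irreducible g -> semitangibly_full_quadratic g ->
  exists I, interval_of g I.
Proof.
move=> irr [sg [ff t2 t0 g1]]; rewrite lead_coefE sg /= in t2.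
have {}g1 : g`_1 \in ghost by apply: g1; rewrite sg.
have low m : (m < 0)%N -> g`_m = 0 by [].
have n0 := tangible_neq0 t0; have n2 := tangible_neq0 t2.
have n1 : g`_1 != 0 by apply: (full_coef_neq0 hF ff low n0); rewrite ?sg.
have [le _] : _ /\ _ := full_concave hF ff low n0 (leqnn 0) ltac:(by rewrite sg).
(* These are the corner roots; [a <= b] in value because [g] is log-concave. *)
pose b := tlift g`_1 * tinv g`_2; pose a := g`_0 * tinv g`_2 * tinv b.
have tb : b \in tangible by rewrite tangibleM ?tangible_tlift ?tangible_tinv.
have b0 := tangible_neq0 tb.
have ta : a \in tangible by rewrite !tangibleM ?tangible_tinv.
have e1 : g`_2 * nu b = g`_1.
  apply: nuv_inj_ghost => //; first by rewrite ghostMl ?nu_ghost.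
  rewrite (nuvM_eq (erefl _) (nuv_nu _)) mulrCA mulV // mulr1.
  exact: nuv_tlift.
have e0 : g`_2 * (a * b) = g`_0.
  have -> : g`_2 * (a * b) = g`_0 * (g`_2 * tinv g`_2) * (b * tinv b).
    by rewrite /a; ring.
  by rewrite !mulV // !mulr1.
have gE x : g.[x] = g`_2 * (x ^+ 2 + nu b * x + a * b).
  by rewrite horner_size3 // !mulrDr e0 [_ * (nu b * x)]mulrA e1.
have E0 : g`_0 * g`_2 = g`_2 * g`_2 * (a * b) by rewrite -[g`_0]e0; ring.
have E1 : nuv (g`_1 * g`_1) = nuv (g`_2 * g`_2 * (b * b)).
  by rewrite -e1 mulrACA; apply: nuvM_eq; rewrite // -nuM nuv_nu.
have n22 := mul_neq0 n2 n2.
have vab : (nuv a < nuv b) = (nuv (g`_0 * g`_2) < nuv (g`_1 * g`_1)).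
  by rewrite E0 E1 nuvM_lt2l // nuvM_lt2r.
rewrite E0 E1 nuvM_le2l // nuvM_le2r // in le.
case: (ltP (nuv a) (nuv b)) => [lt|ba].
  exists (a, Some b); exists g`_2 => //.
  have ab : (a == b) = false by apply/eqP => e; rewrite e ltxx in lt.
  have a0 := tangible_neq0 ta.
  split=> //.
  - by rewrite /gi_valid ta tb lt !orbT.
  - move=> x; rewrite gE /= ab (negbTE a0).
    by rewrite !hornerD hornerXn hornerZ hornerX hornerC.
  - by rewrite /right_kind /= nuv_eq0 (negbTE a0).
  - move=> _; split=> //; exists 1%N; split=> //.
    by apply: (quad_essential hF hG); rewrite -?vab.
case: irr; exists ((g`_2)%:P * 'X + (g`_2 * b)%:P), ('X + a%:P); split.
- move=> x; rewrite gE hornerM !(hornerD, hornerM, hornerX, hornerC).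
  have eab : nuv b = nuv a by apply/eqP; rewrite eq_le ba le.
  by rewrite -(add_veq eab); ring.
- by move=> /(e_constant_size hG); rewrite size_linear.
- by move=> /(e_constant_size hG); rewrite size_XaddC.
Qed.

Lemma factor_interval g : e_irreducible g ->
  [\/ tangible_linear g, semitangibly_full_quadratic g,
      linear_left_ghost g | linear_right_ghost g] ->
  exists I, interval_of g I.
Proof.
move=> irr [[sg tg]|/(quadratic_interval irr)//|[a ta ->]|[a ta ->]].
- have n1 : g`_1 != 0.
    by rewrite (_ : g`_1 = lead_coef g) ?lead_coef_eq0 -?size_poly_gt0 ?lead_coefE sg.
  have t1 : g`_1 \in tangible by apply/tg/eqP.
  pose a := g`_0 * tinv g`_1; exists (a, Some a), g`_1 => //.
  rewrite /nuv_itv /left_kind /right_kind /quad_kind /thin /= !eqxx !andbF.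
  split=> //.
    rewrite /= andbT; case: (eqVneq a 0) => //= a0; apply: tangibleM.
      apply: tg; apply/eqP; apply: contraNneq a0 => g00.
      by rewrite /a g00 mul0r.
    exact: tangible_tinv.
  move=> x; rewrite horner_size2 // hornerD hornerX hornerC mulrDr /a mulrCA.
  by rewrite mulV // mulr1.
- exists (a, None), 1; first exact: tangible1.
  rewrite /right_kind /quad_kind /left_kind /= !andbF; split=> // [x|_].
    by rewrite mul1r.
  by exists a.
- have a0 := tangible_neq0 ta.
  exists (0, Some a), 1; first exact: tangible1.
  rewrite /quad_kind /= !eqxx; split=> //; last by move=> _; exists a.
    by rewrite /= ta nuv_gt0 a0 orbT.
  by move=> x; rewrite mul1r eq_sym (negbTE a0).
Qed.

End Factors.

(** * Coverings by intervals *)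
Section Covers.
Variable F : supertropicalSemifieldType.
Hypothesis hF : divisibly_closed F.
Hypothesis hG : exists2 a : F, a \in tangible & nu a <> nu 1.
Local Notation D := (gval F).
Implicit Types (e g h : D) (I J : D * option D) (S : seq (D * option D)).

Definition itv_valid J : bool :=
  if J.2 is Some h then J.1 <= h else nuv 0 < J.1.

Definition sub_interval I J : bool := (J.1 <= I.1) &&
  match J.2, I.2 with
  | None, _ => true
  | Some h, Some h' => h' <= h
  | Some _, None => false
  end.

Definition covered S (x : D) := has (fun J => covers J x) S.

Definition separated S : Prop := forall I J e, I \in S -> J \in S ->
  ~~ thin I -> ~~ thin J -> covers I e -> covers J e -> I = J.

Definition endpoints S : seq D := [seq J.1 | J <- S] ++ pmap snd S.

Lemma endpoint1 S J : J \in S -> J.1 \in endpoints S.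
Proof. by move=> JS; rewrite mem_cat map_f. Qed.

Lemma endpoint2 S J h : J \in S -> J.2 = Some h -> h \in endpoints S.
Proof.
move=> JS e; rewrite mem_cat; apply/orP; right.
by rewrite mem_pmap -e; apply/mapP; exists J.
Qed.

Lemma covers_lo J : itv_valid J -> covers J J.1.
Proof. by case: J => a [b|]; rewrite /itv_valid /covers /= lexx. Qed.

Lemma sub_interval_covers I J e : sub_interval I J -> covers I e -> covers J e.
Proof.
case: I J => [a [b|]] [c [d|]]; rewrite /sub_interval /covers //= => /andP[ca] bd /andP[ae];
  rewrite (le_trans ca ae) //= => ab; exact: le_trans bd.
Qed.

Lemma thick_lt J h : itv_valid J -> ~~ thin J -> J.2 = Some h -> J.1 < h.
Proof.
case: J => a [b|] //=; rewrite /itv_valid /thin /= => ab ne [<-].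
by rewrite lt_neqAle ab andbT; apply: contraNneq ne => ->.
Qed.

Lemma inner_bound J : itv_valid J -> ~~ thin J ->
  exists2 q, J.1 < q & forall x, J.1 < x -> x < q -> covers J x.
Proof.
case: J => a [b|] vJ tJ.
  exists b; first exact: (thick_lt vJ tJ erefl).
  by move=> x ax xb; rewrite /covers /= !ltW.
have [x tx ax] := nuv_gt_ex hG a; exists (nuv x) => //.
by move=> y ay _; rewrite /covers /= ltW.
Qed.

Lemma cover_right S e q : e < q ->
  (forall x, x \in tangible -> e < nuv x -> nuv x < q -> covered S (nuv x)) ->
  exists J, [/\ J \in S, ~~ thin J, J.1 <= e & forall h, J.2 = Some h -> e < h].
Proof.
move=> eq cS; have [x [tx ex xq xE]] := just_after hF hG (endpoints S) eq.
have /hasP[J JS /andP[lo hi]] := cS x tx ex xq.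
have J1 : J.1 <= e.
  by rewrite leNgt; apply/negP => /(xE _ (endpoint1 JS)); rewrite ltNge lo.
have J2 h : J.2 = Some h -> e < h.
  by move=> eh; rewrite eh in hi; apply: lt_le_trans hi.
exists J; split=> //; apply/negP => /eqP /J2; rewrite ltNge J1 //.
Qed.

Lemma cover_left S g e : g < e ->
  (forall x, x \in tangible -> g < nuv x -> nuv x < e -> covered S (nuv x)) ->
  exists J, [/\ J \in S, ~~ thin J, J.1 < e & forall h, J.2 = Some h -> e <= h].
Proof.
move=> ge cS; have [x [tx gx xe xE]] := just_before hF hG (endpoints S) ge.
have /hasP[J JS /andP[lo hi]] := cS x tx gx xe.
have J1 : J.1 < e by apply: le_lt_trans xe.
have J2 h : J.2 = Some h -> e <= h.
  move=> eh; rewrite leNgt; apply/negP => /(xE _ (endpoint2 JS eh)).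
  by rewrite eh in hi; rewrite ltNge hi.
by exists J; split=> //; apply/negP => /eqP /J2; rewrite leNgt J1.
Qed.

Lemma cover_top S e : (forall x, x \in tangible -> e < nuv x -> covered S (nuv x)) ->
  exists2 J, J \in S & J.2 = None.
Proof.
move=> cS; have [x tx xE] : exists2 x, x \in tangible &
    forall e', e' \in e :: endpoints S -> e' < nuv x.
  elim: (e :: _) => [|e' E [x tx xE]].
    by exists 1; rewrite ?tangible1.
  have [y ty] := nuv_gt_ex hG (Order.max (nuv x) e'); rewrite gt_max => /andP[xy ey].
  exists y => // e2; rewrite inE => /predU1P[->//|/xE e2x]; exact: lt_trans xy.
have /hasP[J JS /andP[_ hi]] := cS x tx (xE _ (mem_head _ _)).
exists J => //; case e2: J.2 => [h|//]; rewrite e2 in hi.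
by have := xE h; rewrite inE (endpoint2 JS e2) orbT ltNge hi => /(_ isT).
Qed.

(** Start from the member that covers the points immediately after the lower end
    of [I]. If [I] went beyond its upper end, the points immediately after that
    end would belong to another member that contains this end. *)
Lemma inside_separated S I : all itv_valid S -> separated S ->
  itv_valid I -> ~~ thin I ->
  (forall x, x \in tangible -> covers I (nuv x) -> covered S (nuv x)) ->
  exists J, [/\ J \in S, ~~ thin J & sub_interval I J].
Proof.
move=> vS sS hI tI cI; have [q Iq qI] := inner_bound hI tI.
have [x tx Ix xq|J [JS tJ J1 J2]] := cover_right Iq (S := S).
  by apply: cI => //; apply: qI.
exists J; split=> //; rewrite /sub_interval J1 /=; case eJ: J.2 => [h|//].
have Ih := J2 _ eJ.
suff: ~ exists2 q', h < q' & forall x, h < x -> x < q' -> covers I x.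
  case: (I) cI {hI tI} Iq qI J1 J2 Ih => a [b|] _ _ _ _ _ /= Ih no.
    rewrite leNgt; apply/negP => hb; apply: no; exists b => // y hy yb.
    by rewrite /covers /= !ltW // (lt_trans Ih).
  case: no; have [y ty hy] := nuv_gt_ex hG h; exists (nuv y) => // z hz _.
  by rewrite /covers /= andbT (ltW (lt_trans Ih hz)).
move=> [q' hq' cq'].
have [y ty hy yq|J' [J'S tJ' J'1 J'2]] := cover_right hq' (S := S).
  by apply: cI => //; apply: cq'.
have eJJ : J = J'.
  apply: (sS J J' h) => //; rewrite /covers.
    by rewrite eJ lexx andbT (ltW (le_lt_trans J1 Ih)).
  by rewrite J'1; case e': J'.2 => [h'|//]; rewrite (ltW (J'2 _ e')).
by have := J'2 h; rewrite -eJJ eJ ltxx => /(_ erefl).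
Qed.

End Covers.

(** * Comparison with a disjoint covering *)

Section Compare.
Variable F : supertropicalSemifieldType.
Hypothesis hF : divisibly_closed F.
Hypothesis hG : exists2 a : F, a \in tangible & nu a <> nu 1.
Local Notation D := (gval F).
Implicit Types (e g h : D) (I J : D * option D).

Definition thick I := ~~ thin I.

Definition value_roots J : seq D :=
  match J with
  | (a, None) => [:: a]
  | (a, Some b) => if a == b then [:: a] else if a == nuv 0 then [:: b] else [:: a; b]
  end.

Lemma thick_count S :
  (all (@itv_valid F) S ->
  count thick S =
    count (@quad_kind F) S + (count (@left_kind F) S + count (@right_kind F) S))%N.
Proof.
elim: S => //= J S IH /andP[vJ /IH ->].
have -> : (thick J : nat) = (quad_kind J + (left_kind J + right_kind J))%N.
  rewrite /quad_kind /right_kind /left_kind /thick /thin.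
  case: J vJ => a [b|] /= vJ.
    by case: (a == nuv 0); case: (Some b == Some a).
  by rewrite !andbF.
lia.
Qed.

Variables S0 S : seq (D * option D).
Hypotheses (v0 : all (@itv_valid F) S0) (vS : all (@itv_valid F) S).
Hypotheses (sep : separated S0) (u0 : uniq (filter thick S0)).
Hypothesis same : forall x : F, x \in tangible ->
  covered S0 (nuv x) = covered S (nuv x).

Lemma inside I : I \in S -> thick I -> exists J, [/\ J \in S0, thick J & sub_interval I J].
Proof.
move=> IS tI; apply: inside_separated => //; first exact: (allP vS).
by move=> x tx cx; rewrite same //; apply/hasP; exists I.
Qed.

(** The thick member of [S] that covers the points immediately after the lower
    end of [J] lies in a member of [S0] that meets [J], hence in [J]. *)
Lemma thick_below J : J \in S0 -> thick J ->
  exists I, [/\ I \in S, thick I, sub_interval I J & I.1 = J.1].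
Proof.
move=> JS tJ; have vJ := allP v0 _ JS.
have [q Jq qJ] := inner_bound hG vJ tJ.
have [x tx Jx xq|I [IS tI I1 I2]] := cover_right hF hG Jq (S := S).
  by rewrite -same //; apply/hasP; exists J => //; apply: qJ.
have [J' [J'S tJ' sub]] := inside IS tI.
have e : J' = J.
  apply: (sep (e := J.1)) => //; last exact: covers_lo.
  case/andP: sub => J'1 sub; rewrite /covers (le_trans J'1 I1) /=.
  case: J'.2 sub => [h|//]; case e2: I.2 => [h'|//] h'h.
  exact: le_trans (ltW (I2 _ e2)) h'h.
exists I; split=> //; first by rewrite -e.
by apply/eqP; rewrite eq_le I1; case/andP: sub; rewrite e.
Qed.

Lemma thick_above J : J \in S0 -> thick J ->
  exists I, [/\ I \in S, thick I, sub_interval I J & I.2 = J.2].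
Proof.
move=> JS tJ; have vJ := allP v0 _ JS.
case eJ: J.2 => [h|].
  have Jh := thick_lt vJ tJ eJ.
  have cJ x : J.1 < x -> x < h -> covers J x.
    by move=> Jx xh; rewrite /covers eJ !ltW.
  have [x tx Jx xq|I [IS tI I1 I2]] := cover_left hF hG Jh (S := S).
    by rewrite -same //; apply/hasP; exists J => //; apply: cJ.
  have [J' [J'S tJ' sub]] := inside IS tI.
  have e : J' = J.
    apply: (sep (e := h)) => //; last by rewrite /covers eJ lexx (ltW Jh).
    case/andP: sub => J'1 sub; rewrite /covers (le_trans J'1 (ltW I1)) /=.
    case: J'.2 sub => [k|//]; case e2: I.2 => [k'|//]; exact/le_trans/I2.
  exists I; split=> //; first by rewrite -e.
  case/andP: sub => _; rewrite e eJ; case e2: I.2 => [k|//] kh.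
  by congr Some; apply/eqP; rewrite eq_le kh (I2 _ e2).
have [x tx Jx|I IS I2] := cover_top hG (e := J.1) (S := S).
  rewrite -same //; apply/hasP; exists J => //.
  by rewrite /covers eJ andbT ltW.
have tI : thick I by rewrite /thick /thin I2.
have [J' [J'S tJ' sub]] := inside IS tI.
have e : J' = J.
  have J'2 : J'.2 = None.
    by case/andP: sub => _; rewrite I2; case: J'.2.
  apply: (sep (e := Order.max J.1 J'.1)) => //.
    by rewrite /covers J'2 le_max lexx orbT.
  by rewrite /covers eJ le_max lexx.
by exists I; split=> //; rewrite -e.
Qed.

(** A choice, for each thick member of the disjoint family, of a thick member of
    the other family inside it. It is injective because the first family is
    disjoint. *)
Definition subthick J : D * option D :=
  if pselect (exists I, [/\ I \in S, thick I & sub_interval I J]) is left h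
  then sval (cid h) else J.

Lemma subthickP J : J \in S0 -> thick J ->
  [/\ subthick J \in S, thick (subthick J) & sub_interval (subthick J) J].
Proof.
move=> JS tJ; rewrite /subthick; case: pselect => [h|[]].
  exact: (svalP (cid h)).
by have [I []] := thick_below JS tJ; exists I.
Qed.

Lemma sub_interval_inj I J J' : I \in S -> J \in S0 -> J' \in S0 ->
  thick J -> thick J' -> sub_interval I J -> sub_interval I J' -> J = J'.
Proof.
move=> IS JS J'S tJ tJ' sJ sJ'; have cI := covers_lo (allP vS _ IS).
by apply: (sep (e := I.1)) => //; [apply: sub_interval_covers sJ _ | apply: sub_interval_covers sJ' _].
Qed.

Lemma subthick_inj : {in filter thick S0 &, injective subthick}.
Proof.
move=> J J'; rewrite !mem_filter => /andP[tJ JS] /andP[tJ' J'S] e.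
have [sS _ sJ] := subthickP JS tJ; have [_ _ sJ'] := subthickP J'S tJ'.
by apply: (sub_interval_inj sS) => //; rewrite e.
Qed.

Lemma count_quad_le : (count (@quad_kind F) S0 <= count (@quad_kind F) S)%N.
Proof.
rewrite -!size_filter -(size_map subthick); apply: uniq_leq_size.
  have qt J : J \in filter (@quad_kind F) S0 -> J \in filter thick S0.
    by rewrite !mem_filter => /andP[/and3P[_ t _] ->]; rewrite andbT.
  rewrite map_inj_in_uniq => [|J J' /qt h /qt]; last exact: subthick_inj.
  have -> : filter (@quad_kind F) S0 = filter (@quad_kind F) (filter thick S0).
    rewrite -filter_predI; apply: eq_filter => J /=.
    by rewrite andb_idr // => /and3P[].
  exact: filter_uniq.
move=> I /mapP[J]; rewrite !mem_filter => /andP[/and3P[n0 t nl] JS] ->.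
have [-> tI /andP[lo hi]] := subthickP JS t.
rewrite andbT /quad_kind [~~ thin _]tI /left_kind /=; apply/andP; split.
  by rewrite gt_eqF //; apply: lt_le_trans lo; rewrite lt_neqAle eq_sym n0 -[J.1]nuv_val nuv0_le.
by apply: contra nl => /eqP e; move: hi; rewrite e /left_kind; case: J.2.
Qed.

Hypothesis quads : (count (@quad_kind F) S <= count (@quad_kind F) S0)%N.
Hypothesis lefts : (count (@left_kind F) S <= 1)%N.
Hypothesis rights : (count (@right_kind F) S <= 1)%N.

Lemma thick_size : (size (filter thick S) <= size (filter thick S0))%N.
Proof.
rewrite !size_filter !thick_count //; apply: leq_add => //; apply: leq_add.
  apply: leq_trans (_ : (has (@left_kind F) S <= _)%N); last first.
    case: hasP => // -[I IS lI].
    have tI : thick I by rewrite /thick /thin (eqP lI).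
    have [J [JS tJ /andP[_]]] := inside IS tI; rewrite (eqP lI) => e.
    by rewrite -has_count; apply/hasP; exists J => //; rewrite /left_kind; case: J.2 e.
  by rewrite has_count; case: (count _ _) lefts => [|[|]].
apply: leq_trans (_ : (has (@right_kind F) S <= _)%N); last first.
  case: hasP => // -[I IS /and3P[/eqP I0 tI _]].
  have [J [JS tJ /andP[lo _]]] := inside IS tI; rewrite I0 in lo.
  have J0 : J.1 = nuv 0 by apply/eqP; rewrite eq_le lo -[J.1]nuv_val nuv0_le.
  rewrite -has_count; apply/hasP; exists J => //; rewrite /right_kind J0 eqxx.
  rewrite [~~ thin J]tJ /=; apply/eqP => e2.
  by have := allP v0 _ JS; rewrite /itv_valid e2 J0 ltxx.
by rewrite has_count; case: (count _ _) rights => [|[|]].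
Qed.

(** By counting, every thick member of [S] is the chosen one of some [J]. So the
    members with the lower end and with the upper end of [J] are the same, and
    this member is [J]. *)
Lemma thick_perm : perm_eq (filter thick S0) (filter thick S).
Proof.
have uP : uniq (map subthick (filter thick S0)).
  by rewrite map_inj_in_uniq //; apply: subthick_inj.
have subP : {subset map subthick (filter thick S0) <= filter thick S}.
  move=> I /mapP[J]; rewrite mem_filter => /andP[tJ JS] ->.
  by have [? ? _] := subthickP JS tJ; rewrite mem_filter; apply/andP.
have szP : (size (filter thick S) <= size (map subthick (filter thick S0)))%N.
  by rewrite size_map thick_size.
have [_ memP] := uniq_min_size uP subP szP.
have uS := leq_size_uniq uP subP szP.
have sub0 : {subset filter thick S0 <= filter thick S}.
  move=> J; rewrite mem_filter => /andP[tJ JS].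
  have uniqI I : I \in S -> thick I -> sub_interval I J -> I = subthick J.
    move=> IS tI sI; have : I \in map subthick (filter thick S0).
      by rewrite memP mem_filter tI.
    case/mapP => J1; rewrite mem_filter => /andP[tJ1 J1S] e.
    have [_ _ s1] := subthickP J1S tJ1; rewrite -e in s1.
    by rewrite e (sub_interval_inj IS J1S JS tJ1 tJ s1 sI).
  have [I1 [I1S t1 s1 e1]] := thick_below JS tJ.
  have [I2 [I2S t2 s2 e2]] := thick_above JS tJ.
  have e12 : I1 = I2 by rewrite (uniqI _ I1S) // (uniqI _ I2S).
  have <- : I1 = J by rewrite [I1]surjective_pairing e1 e12 e2 -surjective_pairing.
  by rewrite mem_filter t1.
apply: uniq_perm => //; apply: (uniq_min_size _ sub0 _).2 => //.
exact: thick_size.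
Qed.

Hypothesis roots : perm_eq (flatten (map value_roots S0)) (flatten (map value_roots S)).

Lemma intervals_perm : perm_eq S0 S.
Proof.
have split S1 : perm_eq S1 (filter thick S1 ++ filter (predC thick) S1).
  by rewrite perm_sym perm_filterC.
have thinE S1 : filter (predC thick) S1 =
    [seq (a, Some a) | a <- flatten (map value_roots (filter (predC thick) S1))].
  elim: S1 => //= -[a b] S1 IH; rewrite /thick /= negbK /thin /=.
  by case: eqP => //= ->; rewrite eqxx /= {1}IH.
have rsplit S1 : perm_eq (flatten (map value_roots S1))
    (flatten (map value_roots (filter thick S1)) ++
     flatten (map value_roots (filter (predC thick) S1))).
  by rewrite -flatten_cat -map_cat; apply/perm_flatten/perm_map.
have thins : perm_eq (flatten (map value_roots (filter (predC thick) S0)))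
    (flatten (map value_roots (filter (predC thick) S))).
  rewrite -(perm_cat2l (flatten (map value_roots (filter thick S0)))).
  rewrite -(permPl (rsplit S0)) (permPl roots) (permPl (rsplit S)) perm_cat2r.
  by rewrite perm_sym; apply/perm_flatten/perm_map/thick_perm.
rewrite (permPl (split S0)) perm_sym (permPl (split S)) perm_sym.
apply: perm_cat; first exact: thick_perm.
by rewrite thinE [X in perm_eq _ X]thinE; apply: perm_map.
Qed.

End Compare.

(** * Roots of a product of linear polynomials *)
Section Roots.
Variable F : supertropicalSemifieldType.
Hypothesis hF : divisibly_closed F.
Hypothesis hG : exists2 a : F, a \in tangible & nu a <> nu 1.
Implicit Types (a b c m x y : F) (R : seq F).

Lemma nuv_prod_const R x : (forall a, a \in R -> nuv a <= nuv x) ->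
  nuv (\prod_(a <- R) (x + a)) = nuv (x ^+ size R).
Proof.
elim: R => [|a R IH] le; first by rewrite big_nil.
rewrite big_cons exprS; apply: nuvM_eq.
  by rewrite nuvD; apply/max_idPl/le/mem_head.
by apply: IH => b bR; apply: le; rewrite inE bR orbT.
Qed.

Lemma nuv_prod_ge R x : nuv (x ^+ size R) <= nuv (\prod_(a <- R) (x + a)).
Proof.
elim: R => [|a R IH]; first by rewrite big_nil.
by rewrite big_cons exprS; apply: nuvM_le; rewrite // nuvD le_max lexx.
Qed.

Lemma prod_neq0 R x : x != 0 -> \prod_(a <- R) (x + a) != 0.
Proof.
move=> x0; rewrite -nuv_gt0; apply: lt_le_trans (nuv_prod_ge R x).
by rewrite nuv_gt0 exp_neq0.
Qed.

Lemma ex_v_max R : R != [::] ->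
  exists2 m, m \in R & forall a, a \in R -> nuv a <= nuv m.
Proof.
elim: R => // a [|b R] IH _.
  by exists a; rewrite ?mem_head // => c; rewrite inE => /eqP->.
have [//|m mR mmax] := IH; case: (leP (nuv a) (nuv m)) => [am|/ltW ma].
  by exists m; rewrite 1?inE ?mR ?orbT // => c; rewrite inE => /predU1P[->|/mmax].
exists a; rewrite ?mem_head // => c; rewrite inE => /predU1P[->//|/mmax].
by move/le_trans; apply.
Qed.

Lemma nuv_gt_all R : exists2 x, x \in tangible & forall a, a \in R -> nuv a <= nuv x.
Proof.
case: (eqVneq R [::]) => [->|/ex_v_max[m _ mmax]].
  by exists 1; rewrite ?tangible1.
have [x tx mx] := nuv_gt_ex hG (nuv m); exists x => // a /mmax am.
exact/(le_trans am)/ltW.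
Qed.

Lemma size_prod_roots c R : c != 0 ->
  size (c *: \prod_(a <- R) ('X + a%:P)) = (size R).+1.
Proof.
move=> c0; rewrite -mul_polyC.
have [p0 sz] : \prod_(a <- R) ('X + a%:P) != 0 :> {poly F} /\
    size (\prod_(a <- R) ('X + a%:P) : {poly F}) = (size R).+1.
  elim: R => [|a R [p0 sz]]; first by rewrite big_nil size_poly1 oner_neq0.
  have q0 : 'X + a%:P != 0 :> {poly F} by rewrite -size_poly_gt0 size_XaddC.
  have s : size (('X + a%:P) * \prod_(a <- R) ('X + a%:P)) = (size R).+2.
    by rewrite poly_size_mul // sz size_XaddC.
  by rewrite big_cons -size_poly_gt0 s.
by rewrite poly_size_mul ?polyC_eq0 // size_polyC c0 sz.
Qed.

Lemma horner_prod_roots c R x :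
  (c *: \prod_(a <- R) ('X + a%:P)).[x] = c * \prod_(a <- R) (x + a).
Proof.
rewrite hornerZ horner_prod; congr (_ * _); apply: eq_bigr => a _.
by rewrite hornerD hornerX hornerC.
Qed.

(** Let [m] be the largest root. If no root of the other product has this value,
    then slightly below [m] the other product is a monomial of the same degree,
    and the first one is strictly larger. So both have a root of value [m], and
    the two factors cancel. *)
Lemma roots_perm_size c R R' : size R = size R' -> c != 0 ->
  (forall x, x \in tangible -> nuv (c * \prod_(a <- R) (x + a)) =
                               nuv (c * \prod_(a <- R') (x + a))) ->
  perm_eq (map (@nuv F) R) (map (@nuv F) R').
Proof.
move=> sz c0 H.
have {H} : forall x, x \in tangible ->
    nuv (\prod_(a <- R) (x + a)) = nuv (\prod_(a <- R') (x + a)).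
  by move=> x /H /eqP; rewrite nuvM_eq2l // => /eqP.
move e : (size R) => n; elim: n R R' sz e => [|n IH] R R' sz e H.
  by rewrite e in sz; rewrite (size0nil e) (size0nil (esym sz)).
have step R1 R2 m : m \in R1 -> (forall a, a \in R1 ++ R2 -> nuv a <= nuv m) ->
    size R1 = n.+1 -> size R2 = n.+1 -> (forall x, x \in tangible ->
    nuv (\prod_(a <- R1) (x + a)) = nuv (\prod_(a <- R2) (x + a))) ->
    perm_eq (map (@nuv F) R1) (map (@nuv F) R2).
  move=> mR mmax s1 s2 {}H; have [m' m'R em] : exists2 m', m' \in R2 & nuv m' = nuv m.
    apply/not_exists2P => no.
    have lt a : a \in R2 -> nuv a < nuv m.
      move=> aR; rewrite lt_neqAle mmax ?mem_cat ?aR ?orbT // andbT.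
      by apply/eqP => em; case: (no a).
    have m0 : nuv 0 < nuv m.
      case: R2 s2 lt {mmax H no} => // a R2 _ lt.
      by apply: le_lt_trans (lt a (mem_head _ _)); apply: nuv0_le.
    have [x [tx _ xm xE]] := just_before hF hG (map (@nuv F) R2) m0.
    have := H _ tx; rewrite (nuv_prod_const (R := R2)); last first.
      by move=> a aR; apply/ltW/xE; rewrite ?map_f ?lt.
    rewrite (big_rem m) //= s2 exprS => /eqP; rewrite gt_eqF //.
    have x0 := tangible_neq0 tx.
    have -> : n = size (rem m R1) by rewrite size_rem // s1.
    apply: nuvM_lt; rewrite ?prod_neq0 ?nuv_prod_ge //.
    by rewrite nuvD lt_max xm orbT.
  rewrite (permPl (perm_map _ (perm_to_rem mR))) /= perm_sym.
  rewrite (permPl (perm_map _ (perm_to_rem m'R))) /= em perm_cons perm_sym.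
  apply: IH; rewrite ?size_rem ?s1 ?s2 // => x tx.
  have := H _ tx; rewrite (big_rem m) // (big_rem m' m'R) /=.
  have -> : nuv ((x + m') * \prod_(y <- rem m' R2) (x + y)) =
            nuv ((x + m) * \prod_(y <- rem m' R2) (x + y)).
    by apply: nuvM_eq; rewrite // !nuvD em.
  move/eqP; rewrite nuvM_eq2l => [/eqP//|].
  by rewrite -nuv_gt0 nuvD lt_max nuv_gt0 tangible_neq0.
have [|m] := @ex_v_max (R ++ R'); first by case: (R) e.
rewrite mem_cat => /orP[] mR mmax; first by apply: step mR mmax _ _ _; rewrite -?sz.
rewrite perm_sym; apply: step mR _ _ _ _; rewrite -?sz //.
  by move=> a; rewrite mem_cat orbC -mem_cat; apply: mmax.
by move=> x /H.
Qed.

Lemma roots_perm c c' R R' : c != 0 -> c' != 0 ->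
  (forall x, x \in tangible -> nuv (c * \prod_(a <- R) (x + a)) =
                               nuv (c' * \prod_(a <- R') (x + a))) ->
  perm_eq (map (@nuv F) R) (map (@nuv F) R').
Proof.
move=> c0 c'0 H; have sz : size R = size R'.
  apply: succn_inj; rewrite -(size_prod_roots R c0) -(size_prod_roots R' c'0).
  by apply: (nuv_eq_size hG) => x tx; rewrite !horner_prod_roots H.
have cc : nuv c = nuv c'.
  have [x tx xmax] := nuv_gt_all (R ++ R'); have x0 := tangible_neq0 tx.
  have ex c1 R1 : (forall a, a \in R1 -> a \in R ++ R') ->
      nuv (c1 * \prod_(a <- R1) (x + a)) = nuv (c1 * x ^+ size R1).
    by move=> sub; apply: nuvM_eq; rewrite // nuv_prod_const // => a /sub/xmax.
  have := H _ tx; rewrite (ex c R) => [|a aR]; last by rewrite mem_cat aR.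
  rewrite (ex c' R') => [|a aR]; last by rewrite mem_cat aR orbT.
  rewrite -sz.
  by move/eqP; rewrite nuvM_eq2r ?exp_neq0 // => /eqP.
apply: (roots_perm_size (c := c)) => // x tx; rewrite H //.
exact: nuvM_eq.
Qed.

End Roots.

(** * Runs of ghost coefficients *)
Section Build.
Variable F : supertropicalSemifieldType.
Implicit Types (a b c lo x y : F) (I J : gval F * option (gval F)) (d : seq (F * bool))
  (o : option F) (p q : F * bool) (t : gval F) (s : bool).

(** A corner [(a, s)] records a corner root [a] and whether the coefficient that
    dominates immediately after [a] is a ghost. Two consecutive roots may have the
    same value only if the coefficient between them is a ghost, since it is then
    quasi-essential. *)
Definition corner_step p q : bool := nuv p.1 < nuv q.1 ?<= if p.2.

(** The ghost status at the value [t], when [s] is the status before the first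
    corner. *)
Fixpoint ghost_at s d t : bool :=
  if d is (a, s') :: d' then
    if t < nuv a then s else (t == nuv a) || ghost_at s' d' t
  else s.

(** Merges the ghost intervals between consecutive corners. The argument [o]
    is the lower end of the run that is open, if there is one; the lower end is 0
    for a run that starts before the first corner. A run that closes at its
    lower end is a multiple root and gives linear factors only. *)
Fixpoint ghost_runs o d : seq (F * option F) :=
  match d, o with
  | [::], None => [::]
  | [::], Some lo => [:: (lo, None)]
  | (a, false) :: d', None => (a, Some a) :: ghost_runs None d'
  | (a, true) :: d', None => ghost_runs (Some a) d'
  | (a, false) :: d', Some lo =>
      (if nuv lo < nuv a then [:: (lo, Some a)] else [:: (lo, Some lo); (a, Some a)])
      ++ ghost_runs None d'
  | (a, true) :: d', Some lo => (a, Some a) :: ghost_runs (Some lo) d'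
  end.

Lemma corner_le p q : corner_step p q -> nuv p.1 <= nuv q.1.
Proof. exact: lteifW. Qed.

Lemma ghost_at_below a s d t : path corner_step (a, s) d -> t < nuv a ->
  ghost_at s d t = s.
Proof.
case: d => //= -[b s'] d /andP[/corner_le /= ab _] ta.
by rewrite (lt_le_trans ta ab).
Qed.

Lemma ghost_at_start a s d t : path corner_step (a, s) d -> t <= nuv a ->
  ghost_at true d t.
Proof.
case: d => //= -[b s'] d /andP[/corner_le /= ab _] ta.
by case: (ltgtP t (nuv b)) (le_trans ta ab).
Qed.

Lemma covered_ghost_runs d a s : path corner_step (a, s) d ->
  (forall t, covered (map (@nuv_itv F) (ghost_runs None d)) t = ghost_at false d t) /\
  (forall lo, nuv lo <= nuv a -> forall t,
     covered (map (@nuv_itv F) (ghost_runs (Some lo) d)) t = (nuv lo <= t) && ghost_at true d t).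
Proof.
elim: d a s => [|[b s'] d IH] a s /=.
  by move=> _; split=> // lo _ t; rewrite /covered /= orbF /covers.
case/andP=> /corner_le /= ab pd; have [IHn IHs] := IH _ _ pd.
have single t x : covers (nuv_itv (x, Some x)) t = (t == nuv x).
  by rewrite /covers /= eq_le andbC.
case: s' pd => pd; split=> [t|lo loa t].
- rewrite IHs //; case: (ltgtP (nuv b) t) => //= e.
  by rewrite -e (ghost_at_start pd).
- rewrite /covered /= single; rewrite -/(covered _ _) IHs; last exact: le_trans ab.
  case: (ltgtP t (nuv b)) => //= e.
    by rewrite (ghost_at_start pd) // ltW.
  by rewrite e (le_trans loa ab).
- rewrite /covered /= single; rewrite -/(covered _ _) IHn.
  by case: (ltgtP t (nuv b)) => //= e; rewrite (ghost_at_below pd).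
have lob := le_trans loa ab.
rewrite /covered map_cat has_cat -/(covered _ _) -[has _ (map _ (ghost_runs _ _))]/(covered _ _) IHn.
case: ifP => lt /=; rewrite ?single orbF.
  rewrite /covers /=; case: (ltgtP t (nuv b)) => //= e.
  - by rewrite (ghost_at_below pd) // orbF.
  - by rewrite andbF (le_trans lob (ltW e)).
  - by rewrite e lob.
have -> : nuv lo = nuv b by apply/eqP; rewrite eq_le lob leNgt lt.
by case: (ltgtP t (nuv b)) => //= e; rewrite (ghost_at_below pd).
Qed.

(** A run that starts at 0 has to end, since no factor is a ghost everywhere. *)
Definition opening d o : bool :=
  if o is Some lo then
    (lo \in tangible) || (lo == 0) && has (fun p => ~~ p.2) d
  else true.

Lemma ghost_runs_valid d o : all (fun p => p.1 \in tangible) d -> opening d o ->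
  all (@gi_valid F) (ghost_runs o d).
Proof.
elim: d o => [|[b s'] d IH] [lo|] //=; first by rewrite andbF orbF andbT.
  case/andP=> tb td; case: s' => /= op.
    by rewrite tb eqxx orbT IH.
  have lo0 : (lo == 0) || (lo \in tangible).
    by case/orP: op => [->|/andP[->]] //; rewrite orbT.
  by rewrite all_cat IH //; case: ifP => /= [->|]; rewrite lo0 ?eqxx tb !orbT.
case/andP=> tb td _; case: s'; first by apply: IH; rewrite //= tb.
by rewrite /= tb eqxx orbT IH.
Qed.

Definition opening_roots o : seq F :=
  if o is Some lo then if lo == 0 then [::] else [:: lo] else [::].

Lemma ghost_runs_roots d o : all (fun p => p.1 \in tangible) d -> opening d o ->
  perm_eq (flatten (map (@gi_roots F) (ghost_runs o d)))
          (opening_roots o ++ map fst d).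
Proof.
elim: d o => [|[b s'] d IH] [lo|] //=.
- by rewrite andbF orbF => _ /tangible_neq0/negbTE->.
- case/andP=> tb td; case: s' => /= op.
    rewrite eqxx /= -cat1s perm_catC.
    rewrite (permPl (perm_cat (IH (Some lo) td op) (perm_refl _))) -catA.
    by rewrite perm_cat2l perm_catC.
  rewrite map_cat flatten_cat.
  have h := IH None td isT.
  case: ifP => lt /=.
    have -> : (lo == b) = false by apply/eqP => e; rewrite e ltxx in lt.
    by case: (lo == 0); rewrite /= ?cats0 /= !perm_cons.
  have -> : (lo == 0) = false.
    by apply/eqP => e; rewrite e nuv_gt0 tangible_neq0 in lt.
  by rewrite !eqxx /= !perm_cons.
- case/andP=> tb td _; case: s' => /=.
    have := IH (Some b) td; rewrite /= tb (negbTE (tangible_neq0 tb)); exact.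
  by rewrite eqxx /= perm_cons; apply: (IH None).
Qed.

Definition before (I J : gval F * option (gval F)) : bool :=
  if I.2 is Some h then h < J.1 else false.

Lemma ghost_runs_separated d a s : path corner_step (a, s) d ->
  (s = false ->
     all (fun J => nuv a < J.1) (filter (@thick F) (map (@nuv_itv F) (ghost_runs None d))) &&
     pairwise before (filter (@thick F) (map (@nuv_itv F) (ghost_runs None d)))) /\
  (forall lo, nuv lo <= nuv a ->
     all (fun J => nuv lo <= J.1) (filter (@thick F) (map (@nuv_itv F) (ghost_runs (Some lo) d))) &&
     pairwise before (filter (@thick F) (map (@nuv_itv F) (ghost_runs (Some lo) d)))).
Proof.
have thinx x : thick (nuv_itv (x, Some x)) = false by rewrite /thick /thin /= eqxx.
elim: d a s => [|[b s'] d IH] a s /=.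
  by move=> _; split=> // lo _; rewrite /= lexx.
case/andP=> abs pd; have ab : nuv a <= nuv b := corner_le abs.
have [IHn IHs] := IH _ _ pd.
have weaken (P Q : pred (gval F * option (gval F))) (l : seq _) : subpred P Q ->
    all P l -> all Q l by move=> PQ; apply: sub_all.
case: s' abs IHn pd => abs IHn pd; split=> [s0|lo loa].
- rewrite {}s0 in abs; have {}/andP[al ->] := IHs b (lexx _); rewrite andbT.
  by apply: weaken al => J; apply: lt_le_trans.
- by rewrite /= thinx; apply: IHs; apply: le_trans ab.
- rewrite {}s0 in abs; rewrite /= thinx; have {}/andP[al ->] := IHn erefl.
  by rewrite andbT; apply: weaken al => J; apply: lt_trans.
have {}/andP[al pw] := IHn erefl; have lob := le_trans loa ab.
have al' : all (fun J => nuv lo <= J.1) (filter (@thick F) (map (@nuv_itv F) (ghost_runs None d))).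
  by apply: weaken al => J /= bJ; apply: ltW (le_lt_trans lob bJ).
rewrite map_cat filter_cat; case: ifP => lt /=; last by rewrite !thinx /= al'.
have -> : thick (nuv_itv (lo, Some b)).
  by rewrite /thick /thin /= (inj_eq (@Some_inj _)) gt_eqF.
by rewrite /= lexx al' pw /= andbT.
Qed.

End Build.

(** * Disjointness of the runs *)
Section Separated.
Variable F : supertropicalSemifieldType.
Local Notation D := (gval F).
Implicit Types (I J : D * option D) (S : seq (D * option D)).

Lemma before_disjoint I J e : before I J -> covers I e -> covers J e -> False.
Proof.
case: I J => [a [b|]] [c h]; rewrite /before /covers //=.
move=> bc /andP[_ eb] /andP[ce _].
by have := le_lt_trans eb (lt_le_trans bc ce); rewrite ltxx.
Qed.

Lemma pairwise_cases (T : eqType) (r : rel T) (s : seq T) (x y : T) :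
  pairwise r s -> x \in s -> y \in s -> [\/ x = y, r x y | r y x].
Proof.
elim: s => // z s IH /= /andP[al pw]; rewrite !inE.
case/predU1P=> [->|xs] /predU1P[->|ys]; first by constructor 1.
- by constructor 2; apply: (allP al).
- by constructor 3; apply: (allP al).
- exact: IH.
Qed.

Lemma pairwise_separated S : all (@itv_valid F) S ->
  pairwise (@before F) (filter (@thick F) S) ->
  separated S /\ uniq (filter (@thick F) S).
Proof.
move=> vS pw; split.
  move=> I J e IS JS tI tJ cI cJ.
  have [||//|b|b] := @pairwise_cases _ _ _ I J pw.
  - by rewrite mem_filter IS andbT.
  - by rewrite mem_filter JS andbT.
  - by case: (before_disjoint b cI cJ).
  - by case: (before_disjoint b cJ cI).
have {vS} : all (@itv_valid F) (filter (@thick F) S).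
  by apply/allP => I; rewrite mem_filter => /andP[_ /(allP vS)].
elim: (filter _ S) pw => //= I T IH /andP[al /IH {}IH] /andP[hI /IH ->].
rewrite andbT; apply/negP => /(allP al) b.
exact: before_disjoint b (covers_lo hI) (covers_lo hI).
Qed.

Lemma count_le1 S (P : pred (D * option D)) : uniq (filter (@thick F) S) ->
  subpred P (@thick F) ->
  (forall I J, I \in S -> J \in S -> P I -> P J -> I = J) ->
  (count P S <= 1)%N.
Proof.
move=> uS PT inj; rewrite -size_filter.
have uP : uniq (filter P S).
  have -> : filter P S = filter P (filter (@thick F) S).
    rewrite -filter_predI; apply: eq_filter => J /=.
    by rewrite andb_idr // => /PT.
  exact: filter_uniq.
have sub I J : I \in filter P S -> J \in filter P S -> I = J.
  by rewrite !mem_filter => /andP[PI IS] /andP[PJ JS]; apply: inj.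
case: (filter P S) uP sub => [|I [|J T]] //= uP sub.
by rewrite (sub I J) ?inE ?eqxx ?orbT // in uP.
Qed.

Lemma separated_left S : separated S -> uniq (filter (@thick F) S) ->
  (count (@left_kind F) S <= 1)%N.
Proof.
have lt I : left_kind I -> thick I by rewrite /left_kind /thick /thin => /eqP->.
move=> sS uS; apply: count_le1 => // I J IS JS lI lJ.
apply: (sS I J (Order.max I.1 J.1)) => //; try exact: lt.
  by rewrite /covers (eqP lI) le_max lexx.
by rewrite /covers (eqP lJ) le_max lexx orbT.
Qed.

Lemma separated_right S : separated S -> uniq (filter (@thick F) S) ->
  (count (@right_kind F) S <= 1)%N.
Proof.
move=> sS uS; apply: count_le1 => // [I /and3P[]//|].
move=> I J IS JS /and3P[I0 tI lI] /and3P[J0 tJ lJ].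
apply: (sS I J (nuv 0)) => //; rewrite /covers ?(eqP I0) ?(eqP J0) lexx /=.
  by case: I.2 => // h; rewrite -[h]nuv_val nuv0_le.
by case: J.2 => // h; rewrite -[h]nuv_val nuv0_le.
Qed.

End Separated.

(** * The function of a polynomial with log-concave coefficients *)
Section Evaluation.
Variable F : supertropicalSemifieldType.
Implicit Types (a b c x y : F) (cs : seq F) (d : seq (F * bool)) (s : bool).

(** The tangible representatives of the coefficients make the products of roots
    telescope, see [corner_mul]. *)
Definition corner b c : F * bool := (tlift b * tinv c, c \in ghost).
Definition corners b cs : seq (F * bool) := pairmap corner b cs.

Definition linear_product b cs x : F :=
  tlift (last b cs) * \prod_(p <- corners b cs) (x + p.1).

Lemma corner_mul b c : c != 0 -> tlift b * tinv c * tlift c = tlift b.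
Proof. by move=> c0; rewrite -mulrA mulV ?mulr1 // tangible_tinv. Qed.

Lemma corners_tangible b cs : b != 0 -> all (fun c => c != 0) cs ->
  all (fun p => p.1 \in tangible) (corners b cs).
Proof.
elim: cs b => //= c cs IH b b0 /andP[c0 cs0].
by rewrite tangibleM ?tangible_tlift ?tangible_tinv //= IH.
Qed.

(** Induction along Horner's rule. Below the first corner the constant term
    dominates, above it the other terms do, and at the corner both have the same
    value. *)
Lemma eval_corners b cs a s x : b != 0 -> all (fun c => c != 0) cs ->
  x \in tangible -> path (@corner_step F) (a, s) (corners b cs) ->
  [/\ (horner_rec (b :: cs) x \in ghost) =
        ghost_at (b \in ghost) (corners b cs) (nuv x),
      surp (horner_rec (b :: cs) x) (linear_product b cs x),
      nuv x <= nuv a -> nuv (horner_rec (b :: cs) x) = nuv b &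
      nuv x < nuv a -> horner_rec (b :: cs) x = b /\ linear_product b cs x = tlift b].
Proof.
elim: cs b a s => [|c cs IH] b a s b0 /= nz tx.
  rewrite /linear_product /= big_nil mulr1 mul0r add0r => _.
  by split=> //; apply: surp_tlift.
case/andP: nz => c0 nz /andP[/corner_le /= ar pd].
have [/= E1 E2 E3 E4] := IH _ _ _ c0 nz tx pd.
set r := tlift b * tinv c in ar pd E1 E2 E3 E4 *.
have x0 := tangible_neq0 tx.
have rc : r * tlift c = tlift b by apply: corner_mul.
have vrc : nuv (r * c) = nuv b.
  by rewrite -(nuv_tlift b0) -rc; apply: nuvM_eq; rewrite // nuv_tlift.
have r0 : r != 0.
  by rewrite mul_neq0 ?tinv_neq0 // tangible_neq0 // tangible_tlift.
set g := horner_rec cs x * x + c in E1 E2 E3 E4 *.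
have PE : linear_product b (c :: cs) x = (x + r) * linear_product c cs x.
  by rewrite /linear_product /= big_cons mulrCA.
have tr : r \in tangible by rewrite tangibleM ?tangible_tlift ?tangible_tinv.
rewrite PE; case: (ltgtP (nuv x) (nuv r)) => [xr|rx|exr].
- have [gE lE] := E4 xr.
  have hE : g * x + b = b.
    by rewrite add_vlt // gE -vrc mulrC nuvM_lt2r.
  have lpE : (x + r) * linear_product c cs x = tlift b.
    by rewrite lE add_vlt.
  by rewrite hE lpE; split=> //; apply: surp_tlift.
- have gc : nuv c <= nuv g by rewrite nuvD le_max lexx orbT.
  have g0 : g != 0.
    by rewrite -nuv_gt0; apply: lt_le_trans gc; rewrite nuv_gt0.
  have hE : g * x + b = g * x.
    rewrite add_vgt // -vrc; apply: lt_le_trans (nuvM_le gc (lexx _)).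
    by rewrite mulrC nuvM_lt2l.
  rewrite hE add_vgt //; split.
  + by rewrite ghost_mul // (negbTE tx) orbF E1.
  + by rewrite mulrC; apply: surpM; [left|].
  + by move=> xa; have := lt_le_trans rx (le_trans xa ar); rewrite ltxx.
  + by move=> xa; have := lt_trans rx (lt_le_trans xa ar); rewrite ltxx.
- have vgx : nuv (g * x) = nuv b.
    by rewrite -vrc mulrC; apply: nuvM_eq; rewrite ?E3 ?exr.
  rewrite (add_veq vgx) (add_veq exr); split=> //.
  + by rewrite nu_ghost.
  + left; apply: nuv_inj_ghost; rewrite ?nu_ghost ?ghostM ?nu_ghost //.
    rewrite nuv_nu; rewrite mulrC; apply: nuvM_eq; first by rewrite nuv_nu.
    exact: surp_nuv.
  + by rewrite nuv_nu.
  + by rewrite ltNge exr ar.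
Qed.

Lemma horner_rec_drop cs l x : (forall m, (m < l)%N -> cs`_m = 0) ->
  horner_rec cs x = horner_rec (drop l cs) x * x ^+ l.
Proof.
elim: l cs => [|l IH] [|c cs] low; rewrite ?drop0 ?mulr1 ?mul0r //=.
rewrite IH => [|m ml]; last by have := low m.+1; apply.
by have := low 0%N => /= ->; rewrite ?addr0 // exprSr mulrA.
Qed.

End Evaluation.

(** * Products of factors and their intervals *)
Section IntervalProducts.
Variable F : supertropicalSemifieldType.
Hypothesis hF : divisibly_closed F.
Hypothesis hG : exists2 a : F, a \in tangible & nu a <> nu 1.
Implicit Types (a b c x y : F) (I : F * option F) (T : seq (F * option F))
  (f p q g : {poly F}).

Lemma nuv_itv_valid I : gi_valid I -> itv_valid (nuv_itv I).
Proof.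
case: I => a [b|]; last by move=> ta; rewrite /itv_valid /= nuv_gt0 tangible_neq0.
move=> hI; rewrite /itv_valid /=; case: (eqVneq a b) => [->|ab]; first exact: lexx.
by have [_ /ltW] := gi_valid_lt hI ab.
Qed.

Lemma nuv_itv_valid_all T : all (@gi_valid F) T -> all (@itv_valid F) (map (@nuv_itv F) T).
Proof. by rewrite all_map; apply: sub_all => I; apply: nuv_itv_valid. Qed.

Lemma value_roots_nuv_itv I : gi_valid I -> value_roots (nuv_itv I) = map (@nuv F) (gi_roots I).
Proof.
case: I => a [b|] // hI; rewrite /=; case: (eqVneq a b) => [->|ab]; first by rewrite eqxx.
have [_ lt _] := gi_valid_lt hI ab; rewrite lt_eqF // nuv_eq0.
by case: eqP.
Qed.

Lemma value_roots_all T : all (@gi_valid F) T ->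
  flatten (map (@value_roots F) (map (@nuv_itv F) T)) =
  map (@nuv F) (flatten (map (@gi_roots F) T)).
Proof.
elim: T => //= I T IH /andP[hI /IH ->].
by rewrite map_cat -value_roots_nuv_itv.
Qed.

Definition gi_prod T x : F := \prod_(I <- T) (gi_poly I).[x].

Lemma gi_prod_surp T x : all (@gi_valid F) T ->
  surp (gi_prod T x) (\prod_(a <- flatten (map (@gi_roots F) T)) (x + a)).
Proof.
rewrite /gi_prod; elim: T => [_|I T IH /= /andP[hI /IH s]].
  by rewrite !big_nil; left.
by rewrite big_cons big_cat; apply: surpM => //; apply: gi_surp.
Qed.

Lemma gi_neq0 I x : gi_valid I -> x != 0 -> (gi_poly I).[x] != 0.
Proof.
move=> hI x0; rewrite -nuv_eq0 (surp_nuv (gi_surp x hI)) nuv_eq0.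
exact: prod_neq0.
Qed.

Lemma gi_prod_neq0 T x : all (@gi_valid F) T -> x != 0 -> gi_prod T x != 0.
Proof.
move=> hT x0; rewrite -nuv_eq0 (surp_nuv (gi_prod_surp x hT)) nuv_eq0.
exact: prod_neq0.
Qed.

Lemma gi_prod_ghost T x : all (@gi_valid F) T -> x \in tangible ->
  (gi_prod T x \in ghost) = covered (map (@nuv_itv F) T) (nuv x).
Proof.
move=> hT tx; have x0 := tangible_neq0 tx; elim: T hT => [_|I T IH /= /andP[hI hT]].
  by rewrite /gi_prod big_nil (negbTE (@tangible1 F)).
rewrite /gi_prod big_cons -/(gi_prod T x) ghost_mul ?gi_neq0 ?gi_prod_neq0 //.
by rewrite IH // gi_poly_ghost.
Qed.

Lemma horner_gi_prod c T x :
  (c *: \prod_(g <- map (@gi_poly F) T) g).[x] = c * gi_prod T x.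
Proof. by rewrite hornerZ horner_prod big_map. Qed.

Lemma count_le_in (A : eqType) (s : seq A) (P Q : pred A) :
  {in s, forall z, P z -> Q z} -> (count P s <= count Q s)%N.
Proof.
elim: s => //= z s IH PQ; apply: leq_add.
  by have := PQ z (mem_head _ _); case: (P z) => // ->.
by apply: IH => y ys; apply: PQ; rewrite inE ys orbT.
Qed.

Lemma gi_poly_kind I : gi_valid I ->
  [/\ linear_left_ghost (gi_poly I) -> left_kind (nuv_itv I),
      linear_right_ghost (gi_poly I) -> right_kind (nuv_itv I),
      ghost_quadratic (gi_poly I) -> quad_kind (nuv_itv I) &
      e_irreducible (gi_poly I) /\ [\/ tangible_linear (gi_poly I),
        semitangibly_full_quadratic (gi_poly I),
        linear_left_ghost (gi_poly I) | linear_right_ghost (gi_poly I)]].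
Proof.
move=> hI; have sz := size_gi_poly hI.
have n1 : (1 : F) \notin ghost := @tangible1 F.
have size_left p : linear_left_ghost p -> size p = 2%N /\ p`_1 \in ghost.
  case=> a ta ->; rewrite -mul_polyC size_linear.
    by rewrite coefD coefMX !coefC /= addr0 nu_ghost.
  by rewrite nu_neq0 // tangible_neq0 ?tangible1.
have size_right p : linear_right_ghost p ->
    [/\ size p = 2%N, p`_0 \in ghost & p`_0 != 0].
  case=> a ta ->; rewrite size_XaddC coefD coefX coefC /= add0r nu_ghost.
  by rewrite nu_neq0 // tangible_neq0.
have quadk : quad_kind (nuv_itv I) -> size (gi_poly I) = 3%N by move=> q; rewrite sz q.
have linirr : ~~ quad_kind (nuv_itv I) -> e_irreducible (gi_poly I).
  by move=> /negbTE q; apply: (linear_irreducible hG); rewrite sz q.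
case: (boolP (left_kind (nuv_itv I))) => [lI|nl].
  have [/(_ lI)[a ta eI] _ _] := gi_valid_kinds hI.
  have nq : ~~ quad_kind (nuv_itv I) by rewrite /quad_kind lI !andbF.
  split=> //; last first.
  - by split; [exact: linirr | constructor 3; exists a => //; rewrite eI].
  - by case; rewrite sz (negbTE nq).
  - move=> /size_right[_]; rewrite eI /= coefD coefZ coefX coefC /= mulr0 add0r.
    by rewrite (negbTE ta).
have NL : linear_left_ghost (gi_poly I) -> False.
  case/size_left=> s2; case: I hI sz s2 nl {quadk linirr} => a [b|] //= hI sz.
  case: (eqVneq a b) => ab.
    by rewrite coefD coefX coefC /= addr0 (negbTE n1).
  case: eqP => [a0|/eqP a0].
    by rewrite coefD coefX coefC /= addr0 (negbTE n1).
  move: sz; rewrite /= (negbTE ab) (negbTE a0) => -> s2.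
  suff : quad_kind (nuv_itv (a, Some b)) by case: (quad_kind _) s2.
  have [_ lt _] := gi_valid_lt hI ab.
  by rewrite /quad_kind /thin /left_kind /= nuv_eq0 a0 (inj_eq (@Some_inj _)) gt_eqF.
split=> //.
- case/size_right=> s2 g0 n0; case: I hI sz s2 g0 n0 nl {quadk linirr NL} => a [b|] //= hI sz.
  case: (eqVneq a b) => ab.
    rewrite coefD coefX coefC /= add0r => _ ga a0; case/andP: hI.
    by rewrite (negbTE a0) /= tangibleN ga.
  have [tb lt ta] := gi_valid_lt hI ab.
  have nt : thin (nuv_itv (a, Some b)) = false.
    by rewrite /thin /= (inj_eq (@Some_inj _)) gt_eqF.
  rewrite /right_kind nt /left_kind /= nuv_eq0 => s2 _ _ _; rewrite andbT.
  apply/negPn/negP => a0; move: sz s2; rewrite /= (negbTE ab) (negbTE a0) => ->.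
  by rewrite /quad_kind nt /= nuv_eq0 a0.
- by case; rewrite sz; case: (quad_kind _).
case: (boolP (quad_kind (nuv_itv I))) => [qI|nq]; last first.
  split; first exact: linirr.
  case: (boolP (right_kind (nuv_itv I))) => [rI|nr].
    have [_ /(_ rI)[b tb eI] _] := gi_valid_kinds hI.
    constructor 4; exists b => //; rewrite eI /= eq_sym (negbTE (tangible_neq0 tb)).
    by rewrite eqxx.
  have th : thin (nuv_itv I).
    apply: contraT => nt; case: (boolP ((nuv_itv I).1 == nuv 0)) => z.
      by rewrite /right_kind z nt nl in nr.
    by rewrite /quad_kind z nt nl in nq.
  constructor 1; case: I hI th {sz quadk linirr nl NL nq nr} => a [b|] //= hI th.
  have ab : a = b.
    apply/eqP; apply: contraTT th => ab; have [_ lt _] := gi_valid_lt hI ab.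
    by rewrite /thin /= (inj_eq (@Some_inj _)) gt_eqF.
  rewrite {}ab /= eqxx andbT in hI *; rewrite /tangible_linear size_XaddC; split=> // i.
  rewrite coefD coefX coefC; case: i => [|[|i]] /=; rewrite ?add0r ?addr0.
  - by case: (eqVneq b 0) hI => [->|_] //=.
  - by rewrite tangible1.
  - by [].
split; first exact: (quad_irreducible hF hG).
constructor 2.
have [_ _ /(_ qI)[a [b [ta tb lt eI]]]] := gi_valid_kinds hI.
have ab : (a == b) = false by apply/eqP => e; rewrite e ltxx in lt.
have [a0 b0] := (tangible_neq0 ta, tangible_neq0 tb).
have pE : gi_poly I = 'X^2 + nu b *: 'X + (a * b)%:P by rewrite eI /= ab (negbTE a0).
have c0 : (gi_poly I)`_0 = a * b.
  by rewrite pE !coefD coefXn coefZ coefX coefC /= mulr0 !add0r.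
have c1 : (gi_poly I)`_1 = nu b.
  by rewrite pE !coefD coefXn coefZ coefX coefC /= mulr1 addr0 add0r.
have c2 : (gi_poly I)`_2 = 1.
  by rewrite pE !coefD coefXn coefZ coefX coefC /= mulr0 !addr0.
have s3 := quadk qI; split=> //; split.
- apply: (quad_full hF hG); rewrite ?c0 ?c1 ?c2 ?mul_neq0 ?nu_neq0 ?nu_ghost //.
    exact: tangible_neq0 tangible1.
  by rewrite mulr1 -nuM nuv_nu nuvM_lt2r.
- by rewrite lead_coefE s3 c2 tangible1.
- by rewrite c0 tangibleM.
- by rewrite s3 => -[|[|i]] //= _; rewrite c1 nu_ghost.
Qed.

Lemma gi_factorization f c T : c != 0 -> all (@gi_valid F) T ->
  (forall x, x \in tangible -> f.[x] = c * gi_prod T x) ->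
  (count (@left_kind F) (map (@nuv_itv F) T) <= 1)%N ->
  (count (@right_kind F) (map (@nuv_itv F) T) <= 1)%N ->
  factorization f c (map (@gi_poly F) T).
Proof.
move=> c0 hT fE lT rT; split; first exact/eqP.
- by apply: (e_equiv_tangible hG) => x tx; rewrite horner_gi_prod fE.
- by move=> g /mapP[I IT ->]; have [_ _ _] := gi_poly_kind (allP hT _ IT).
- apply: leq_trans lT; rewrite !count_map; apply: count_le_in => I IT /=.
  by have [h _ _ _] := gi_poly_kind (allP hT _ IT); move=> /asboolP.
- apply: leq_trans rT; rewrite !count_map; apply: count_le_in => I IT /=.
  by have [_ h _ _] := gi_poly_kind (allP hT _ IT); move=> /asboolP.
Qed.

Lemma gi_ghost_count T : all (@gi_valid F) T ->
  (ghost_count (map (@gi_poly F) T) <= count (@quad_kind F) (map (@nuv_itv F) T))%N.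
Proof.
move=> hT; rewrite /ghost_count !count_map; apply: count_le_in => I IT /=.
by have [_ _ h _] := gi_poly_kind (allP hT _ IT); move=> /asboolP.
Qed.

Lemma factor_intervals f c (s : seq {poly F}) : factorization f c s ->
  exists iv : {poly F} -> F * option F,
  [/\ forall g, g \in s -> interval_of g (iv g),
      all (@gi_valid F) (map iv s),
      exists2 u, u \in tangible & forall x, f.[x] = c * (u * gi_prod (map iv s) x),
      (count (@left_kind F) (map (@nuv_itv F) (map iv s)) <= 1)%N /\
      (count (@right_kind F) (map (@nuv_itv F) (map iv s)) <= 1)%N &
      (count (@quad_kind F) (map (@nuv_itv F) (map iv s)) <= ghost_count s)%N].
Proof.
case=> c0 fE fs ls rs.
have /choice[iv ivP] : forall g, exists I, g \in s -> interval_of g I.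
  move=> g; case: (boolP (g \in s)) => gs; last by exists (0, None).
  have [irr k] := fs _ gs; have [I hI] := factor_interval hF hG irr k.
  by exists I.
exists iv; split=> //.
- by apply/allP => I /mapP[g gs ->]; have [u _ []] := ivP _ gs.
- suff [u tu uE] : exists2 u, u \in tangible &
      forall x, \prod_(g <- s) g.[x] = u * gi_prod (map iv s) x.
    by exists u => // x; rewrite fE hornerZ horner_prod uE.
  elim: s ivP {fE fs ls rs} => [_|g s IH ivP].
    exists 1; first exact: tangible1.
    by move=> x; rewrite /gi_prod !big_nil mulr1.
  have [|u tu uE] := IH; first by move=> h hs; apply: ivP; rewrite inE hs orbT.
  have [w tw [_ wE _ _ _]] := ivP _ (mem_head _ _).
  exists (w * u); first exact: tangibleM.
  by move=> x; rewrite /gi_prod /= !big_cons uE wE mulrACA.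
- split; [apply: leq_trans ls | apply: leq_trans rs];
    rewrite !count_map; apply: count_le_in => g gs /= k; apply/asboolP;
    have [u _ [_ _ kl kr _]] := ivP _ gs; [exact: kl | exact: kr].
- rewrite /ghost_count !count_map; apply: count_le_in => g gs /= k; apply/asboolP.
  by have [u _ [_ _ _ _ kq]] := ivP _ gs; exact: kq.
Qed.

End IntervalProducts.

(** * Existence *)
Section Existence.
Variable F : supertropicalSemifieldType.
Hypothesis hF : divisibly_closed F.
Hypothesis hG : exists2 a : F, a \in tangible & nu a <> nu 1.
Implicit Types (a b c x y : F) (T : seq (F * option F)) (f g : {poly F}).

Lemma order_exists f : f <> 0 ->
  exists l, (forall m, (m < l)%N -> f`_m = 0) /\ f`_l != 0.
Proof.
move=> f0; have ex : exists i, f`_i != 0.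
  by exists (size f).-1; rewrite -lead_coefE lead_coef_eq0; apply/eqP.
exists (ex_minn ex); case: ex_minnP => l fl lmin; split=> // m ml.
by apply/eqP; apply: contraTT ml; rewrite -leqNgt; apply: lmin.
Qed.

Lemma coef_neq0_lt f k : f`_k != 0 -> (k < size f)%N.
Proof. by rewrite ltnNge; apply: contra => /(nth_default _) ->. Qed.

Lemma corner_step_corners a b c : b != 0 -> c != 0 -> a != 0 ->
  nuv (a * c) <= nuv (b * b) -> (nuv (a * c) = nuv (b * b) -> b \in ghost) ->
  corner_step (corner a b) (corner b c).
Proof.
move=> b0 c0 a0; have bc0 := mul_neq0 b0 c0.
have E1 : nuv (tlift a * tinv b * (b * c)) = nuv (a * c).
  rewrite mulrACA mulrA -mulrA [tinv b * c]mulrC mulrA; apply/eqP.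
  have -> : tlift a * b * c * tinv b = (tlift a * c) * (b * tinv b) by ring.
  apply/eqP; rewrite -[a * c]mulr1; apply: nuvM_eq; last exact: nuv_mulV.
  by apply: nuvM_eq; rewrite ?nuv_tlift.
have E2 : nuv (tlift b * tinv c * (b * c)) = nuv (b * b).
  have -> : tlift b * tinv c * (b * c) = (tlift b * b) * (c * tinv c) by ring.
  rewrite -[b * b]mulr1; apply: nuvM_eq; last exact: nuv_mulV.
  by apply: nuvM_eq; rewrite ?nuv_tlift.
rewrite -E1 -E2 (nuvM_le2r _ _ bc0) /corner_step /corner /= => le eq.
case: (boolP (b \in ghost)) => //= tb; rewrite lt_neqAle le andbT.
by apply: contra tb => e; apply: eq; apply/eqP; rewrite nuvM_eq2r.
Qed.

(** The initial corner 0 lies below all roots. *)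
Lemma corners_path f l : full f -> (forall m, (m < l)%N -> f`_m = 0) ->
  f`_l != 0 -> path (@corner_step F) (0, f`_l \in ghost) (corners f`_l (drop l.+1 f)).
Proof.
move=> ff low fl; have nz := full_coef_neq0 hF ff low fl.
apply/(pathP (0, false)) => i; rewrite size_pairmap size_drop => isz.
have nE j : (j < size f - l.+1)%N ->
    nth (0, false) (corners f`_l (drop l.+1 f)) j = corner f`_(l + j) f`_(l + j).+1.
  move=> jsz; rewrite (nth_pairmap 0) ?size_drop // nth_drop addSn; congr corner.
  by case: j jsz => [|j] jsz; rewrite ?addn0 //= nth_drop addSnnS.
rewrite nE //; case: i isz => [|i] isz0 /=.
  have isz : (l.+1 < size f)%N by rewrite -subn_gt0.
  rewrite addn0; have f1 : f`_l.+1 != 0 by apply: nz; lia.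
  have r0 : nuv 0 < nuv (tlift f`_l * tinv f`_l.+1).
    by rewrite nuv_gt0 mul_neq0 ?tinv_neq0 // tangible_neq0 ?tangible_tlift.
  by rewrite /corner_step /=; case: (_ \in ghost) => //=; apply: ltW.
rewrite nE; last exact: ltnW; rewrite addnS.
have isz : ((l + i).+2 < size f)%N by move: isz0; rewrite ltn_subRL addnS addSn.
have [le eq] : _ /\ _ := full_concave hF ff low fl (leq_addr i l) ltac:(lia).
by apply: corner_step_corners => //; apply: nz; lia.
Qed.

Lemma drop_neq0 f l : full f -> (forall m, (m < l)%N -> f`_m = 0) ->
  f`_l != 0 -> all (fun c => c != 0) (drop l.+1 f).
Proof.
move=> ff low fl; apply/(all_nthP 0) => i; rewrite size_drop nth_drop ltn_subRL => isz.
by apply: (full_coef_neq0 hF ff low fl) isz; rewrite addSn leqW ?leq_addr.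
Qed.

Lemma eval_full f l x : full f -> (forall m, (m < l)%N -> f`_m = 0) ->
  f`_l != 0 -> x \in tangible ->
  exists h, [/\ f.[x] = h * x ^+ l,
    (h \in ghost) = ghost_at (f`_l \in ghost) (corners f`_l (drop l.+1 f)) (nuv x) &
    surp h (linear_product f`_l (drop l.+1 f) x)].
Proof.
move=> ff low fl tx; have nz := drop_neq0 ff low fl.
have [E1 E2 _ _] := eval_corners fl nz tx (corners_path ff low fl).
exists (horner_rec (f`_l :: drop l.+1 f) x); split=> //.
by rewrite -drop_nth ?coef_neq0_lt // -horner_rec_drop.
Qed.

Definition indeterminates l : seq (F * option F) := nseq l (0, Some 0).

Lemma gi_prod_indeterminates l T x : gi_prod (indeterminates l ++ T) x = x ^+ l * gi_prod T x.
Proof.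
rewrite /gi_prod; elim: l => [|l IH]; first by rewrite mul1r.
by rewrite /= big_cons IH /= eqxx hornerD hornerX hornerC addr0 exprS mulrA.
Qed.

Lemma indeterminates_valid l : all (@gi_valid F) (indeterminates l).
Proof. by elim: l => //= l ->; rewrite !eqxx. Qed.

Lemma indeterminates_kind l T : [/\
  count (@left_kind F) (map (@nuv_itv F) (indeterminates l ++ T)) = count (@left_kind F) (map (@nuv_itv F) T),
  count (@right_kind F) (map (@nuv_itv F) (indeterminates l ++ T)) = count (@right_kind F) (map (@nuv_itv F) T),
  count (@quad_kind F) (map (@nuv_itv F) (indeterminates l ++ T)) = count (@quad_kind F) (map (@nuv_itv F) T) &
  filter (@thick F) (map (@nuv_itv F) (indeterminates l ++ T)) = filter (@thick F) (map (@nuv_itv F) T)].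
Proof.
elim: l => //= l [-> -> -> ->].
by rewrite /right_kind /quad_kind /left_kind /thick /thin /= !eqxx.
Qed.

Lemma linear_productE f l T x : perm_eq (flatten (map (@gi_roots F) T))
    (map fst (corners f`_l (drop l.+1 f))) ->
  linear_product f`_l (drop l.+1 f) x = tlift (last f`_l (drop l.+1 f)) *
    \prod_(a <- flatten (map (@gi_roots F) T)) (x + a).
Proof. by move=> /(perm_big _) ->; rewrite big_map. Qed.

Lemma last_neq0 f l : full f -> (forall m, (m < l)%N -> f`_m = 0) ->
  f`_l != 0 -> last f`_l (drop l.+1 f) != 0.
Proof.
move=> ff low fl; have /allP nz := drop_neq0 ff low fl.
by have := mem_last f`_l (drop l.+1 f); rewrite inE => /predU1P[->//|/nz].
Qed.

(** Both sides surpass the product of the linear polynomials of the corner roots,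
    so only their ghost sets have to be compared. *)
Lemma reduced_factorization f : f <> 0 -> full f ->
  (exists i, f`_i \in tangible) -> exists c T,
  [/\ c \in tangible, all (@gi_valid F) T,
      forall x, x \in tangible -> f.[x] = c * gi_prod T x,
      separated (map (@nuv_itv F) T) & uniq (filter (@thick F) (map (@nuv_itv F) T))].
Proof.
move=> f0 ff [i ti]; have [l [low fl]] := order_exists f0.
have nz := drop_neq0 ff low fl; have pd := corners_path ff low fl.
have td := corners_tangible fl nz.
set d := corners _ _ in pd td; set s := f`_l \in ghost in pd *.
(* A ghost lowest coefficient opens a run at 0. *)
pose o : option F := if s then Some 0 else None.
have op : opening d o.
  rewrite /o /s; case: ifP => //= gl; rewrite eqxx orbC /=; apply/orP; left.
  have i0 := tangible_neq0 ti; have isz := coef_neq0_lt i0.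
  have li : (l < i)%N.
    rewrite ltnNge; apply/negP; rewrite leq_eqVlt => /predU1P[e|/low e].
      by move: ti; rewrite e tangibleN gl.
    by rewrite e eqxx in i0.
  have memi : f`_i \in drop l.+1 f.
    rewrite -(subnKC li) -nth_drop mem_nth // size_drop.
    by rewrite ltn_sub2r // (leq_ltn_trans li).
  rewrite /d; elim: (drop _ _) (f`_l) memi => //= c cs IH b.
  rewrite inE => /predU1P[<-|/IH ->]; last by rewrite orbT.
  by move: ti; rewrite tangibleN => ->.
have vT := ghost_runs_valid td op; have rT := ghost_runs_roots td op.
have {}rT : perm_eq (flatten (map (@gi_roots F) (ghost_runs o d))) (map fst d).
  by apply: (perm_trans rT); rewrite /o; case: (s); rewrite //= eqxx.
have vT' : all (@gi_valid F) (indeterminates l ++ ghost_runs o d) by rewrite all_cat indeterminates_valid.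
exists (tlift (last f`_l (drop l.+1 f))), (indeterminates l ++ ghost_runs o d); split=> //.
- exact/tangible_tlift/last_neq0.
- move=> x tx; have [h [-> E1 E2]] := eval_full ff low fl tx.
  rewrite gi_prod_indeterminates mulrCA mulrC; congr (_ * _).
  rewrite (linear_productE x rT) in E2; apply: (surp_eq E2).
    by apply: surpM; [left | apply: gi_prod_surp].
  have x0 := tangible_neq0 tx.
  have c0 := tangible_tlift (last_neq0 ff low fl).
  rewrite ghost_mul ?gi_prod_neq0 ?(tangible_neq0 c0) // (negbTE c0) /=.
  rewrite gi_prod_ghost // E1 -/s -/d; have [cn cs] := covered_ghost_runs pd.
  rewrite /o; case: (s); last by rewrite cn.
  by rewrite (cs 0 (lexx _)) nuv0_le.
- have [_ _ _ fT] := indeterminates_kind l (ghost_runs o d).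
  apply: (pairwise_separated (nuv_itv_valid_all vT') _).1; rewrite fT.
  have [sn ss] := ghost_runs_separated pd; rewrite /o; case e: (s) sn => sn.
    by have /andP[] := ss 0 (lexx _).
  by have /andP[] := sn erefl.
- have [_ _ _ fT] := indeterminates_kind l (ghost_runs o d).
  apply: (pairwise_separated (nuv_itv_valid_all vT') _).2; rewrite fT.
  have [sn ss] := ghost_runs_separated pd; rewrite /o; case e: (s) sn => sn.
    by have /andP[] := ss 0 (lexx _).
  by have /andP[] := sn erefl.
Qed.

Definition linears (d : seq (F * bool)) : seq (F * option F) :=
  [seq (p.1, Some p.1) | p <- d].

Lemma linears_valid d : all (fun p => p.1 \in tangible) d ->
  all (@gi_valid F) (linears d).
Proof. by elim: d => //= p d IH /andP[-> /IH ->]; rewrite eqxx orbT. Qed.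

Lemma linears_kind d : [/\ count (@left_kind F) (map (@nuv_itv F) (linears d)) = 0%N,
  count (@right_kind F) (map (@nuv_itv F) (linears d)) = 0%N &
  count (@quad_kind F) (map (@nuv_itv F) (linears d)) = 0%N].
Proof.
elim: d => //= p d [-> -> ->].
by rewrite /right_kind /quad_kind /left_kind /thin /= !eqxx !andbF.
Qed.

Lemma linears_roots d : flatten (map (@gi_roots F) (linears d)) = map fst d.
Proof. by elim: d => //= p d ->; rewrite eqxx. Qed.

Lemma corner_path_last (p : F * bool) d : path (@corner_step F) p d -> nuv p.1 <= nuv (last p d).1.
Proof.
elim: d p => //= q d IH p /andP[/corner_le pq /IH]; exact: le_trans.
Qed.

Lemma ghost_at_all d (t : gval F) : all (fun p => p.2) d -> ghost_at true d t.
Proof.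
by elim: d => //= -[a s] d IH /andP[/= -> /IH ->]; rewrite orbT; case: ifP.
Qed.

(** With at least two roots, the half-line to the right of the smallest root and
    the half-line to the left of the largest one cover all values. With at most
    one root there is, apart from indeterminates, room for one linear factor
    only, and a ghost constant is taken instead. *)
Lemma ghost_factorization f : f <> 0 -> full f ->
  ~ (exists i, f`_i \in tangible) -> exists c T,
  [/\ c != 0, all (@gi_valid F) T,
      forall x, x \in tangible -> f.[x] = c * gi_prod T x,
      [/\ (count (@left_kind F) (map (@nuv_itv F) T) <= 1)%N,
        (count (@right_kind F) (map (@nuv_itv F) T) <= 1)%N &
        count (@quad_kind F) (map (@nuv_itv F) T) = 0%N] &
      (2 < count (predC1 (0%R : F)) f)%N -> c \in tangible].
Proof.
move=> f0 ff nt; have gh i : f`_i \in ghost.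
  by apply: contraT => ti; case: nt; exists i.
have [l [low fl]] := order_exists f0.
have nz := drop_neq0 ff low fl; have pd := corners_path ff low fl.
have td := corners_tangible fl nz.
have gd : all (fun p => p.2) (corners f`_l (drop l.+1 f)).
  have : all (fun c => c \in ghost) (drop l.+1 f).
    by apply/(all_nthP 0) => i _; rewrite nth_drop.
  by elim: (drop _ _) (f`_l) => //= c cs IH b /andP[-> /IH ->].
have ev x (tx : x \in tangible) := eval_full ff low fl tx.
have lastn := last_neq0 ff low fl; have c0 := tangible_tlift lastn.
rewrite (gh l) in pd ev.
have cnt : (count (predC1 (0%R : F)) f <= (size (corners (f`_l)%R (drop l.+1 f))).+1)%N.
  have -> : count (predC1 (0 : F)) f = count (predC1 (0 : F)) (take l f ++ drop l f).
    by rewrite cat_take_drop.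
  rewrite size_pairmap count_cat.
  have -> : count (predC1 (0 : F)) (take l f) = 0%N.
    apply/eqP; rewrite -leqn0 leqNgt -has_count; apply/(has_nthP 0) => -[i].
    rewrite size_take_min leq_min => /andP[il _]; rewrite nth_take //.
    by rewrite /= low ?eqxx.
  rewrite add0n; apply: leq_trans (count_size _ _) _.
  by rewrite (drop_nth 0) ?coef_neq0_lt.
case: (leqP (size (corners f`_l (drop l.+1 f))) 1) => sz.
  exists (nu (tlift (last f`_l (drop l.+1 f)))),
    (indeterminates l ++ linears (corners f`_l (drop l.+1 f))).
  have [-> -> -> _] := indeterminates_kind l (linears (corners f`_l (drop l.+1 f))).
  have [-> -> ->] := linears_kind (corners f`_l (drop l.+1 f)).
  have vT := linears_valid td.
  split=> //; [exact/nu_neq0/tangible_neq0 | by rewrite all_cat indeterminates_valid | | ].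
    move=> x tx; have [h [-> E1 E2]] := ev x tx.
    rewrite gi_prod_indeterminates mulrCA mulrC; congr (_ * _).
    rewrite (linear_productE (T := linears (corners f`_l (drop l.+1 f)))) in E2; last first.
      by rewrite linears_roots perm_refl.
    apply: nuv_inj_ghost; rewrite ?ghostM ?nu_ghost // ?E1 ?ghost_at_all //.
    rewrite (surp_nuv E2); apply: nuvM_eq; rewrite ?nuv_nu //.
    exact/esym/surp_nuv/gi_prod_surp.
  by move=> c2; have := leq_trans c2 cnt; rewrite ltnS ltnNge sz.
case e : (corners f`_l (drop l.+1 f)) sz pd td gd ev cnt => [//|p d'].
case: (lastP d') e => [//|d q] e _ pd td gd ev _.
exists (tlift (last f`_l (drop l.+1 f))),
  (indeterminates l ++ (p.1, None) :: (0, Some q.1) :: linears d).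
have [-> -> -> _] := indeterminates_kind l ((p.1, None) :: (0, Some q.1) :: linears d).
have [dl dr dq] := linears_kind d.
move: td; rewrite /= all_rcons => /and3P[tp tq td].
have q0 := tangible_neq0 tq.
have nq0 : (0 == q.1) = false by rewrite eq_sym (negbTE q0).
have vT : all (@gi_valid F) ((p.1, None) :: (0, Some q.1) :: linears d).
  by rewrite /= tp eqxx tq nuv_gt0 q0 orbT linears_valid.
have nvq : (Some (nuv q.1) == Some (nuv 0)) = false.
  by rewrite (inj_eq (@Some_inj _)) nuv_eq0 (negbTE q0).
split=> //; first exact: tangible_neq0.
- by rewrite all_cat indeterminates_valid.
- move=> x tx; have [h [-> E1 E2]] := ev x tx.
  rewrite gi_prod_indeterminates mulrCA mulrC; congr (_ * _).
  rewrite (linear_productE (T := (p.1, None) :: (0, Some q.1) :: linears d)) in E2; last first.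
    rewrite e /= nq0 eqxx /= linears_roots map_rcons perm_cons.
    by rewrite -cats1 perm_sym perm_catC.
  apply: (surp_eq E2); first by apply: surpM; [left | apply: gi_prod_surp].
  rewrite E1 ghost_at_all // ghost_mul ?gi_prod_neq0 ?(tangible_neq0 c0) ?(tangible_neq0 tx) //.
  rewrite (negbTE c0) gi_prod_ghost // /covered /= /covers /= nuv0_le andbT.
  have pq : nuv p.1 <= nuv q.1.
    by case/andP: pd => _ /corner_path_last; rewrite last_rcons.
  by case: (leP (nuv p.1) (nuv x)) => //= xp; rewrite (le_trans (ltW xp) pq).
- split; rewrite /= ?dl ?dr ?dq /left_kind /right_kind /quad_kind /thin /= ?nvq ?eqxx ?andbF //.
Qed.

End Existence.

(** * Minimality and uniqueness *)
Section Uniqueness.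
Variable F : supertropicalSemifieldType.
Hypothesis hF : divisibly_closed F.
Hypothesis hG : exists2 a : F, a \in tangible & nu a <> nu 1.
Implicit Types (a b c x y : F) (I J : F * option F) (T : seq (F * option F))
  (f g h : {poly F}) (s : seq {poly F}).

(** In a disjoint family that covers all values, the member that reaches down to
    0 would have no upper end, and no factor has such an interval. *)
Lemma separated_gap (S : seq (gval F * option (gval F))) :
  all (@itv_valid F) S -> separated S ->
  exists2 x : F, x \in tangible & ~~ covered S (nuv x).
Proof.
move=> vS sS; apply/not_exists2P => no.
have {no} cS x : x \in tangible -> covered S (nuv x).
  by move=> tx; case: (no x) => // /negP; rewrite negbK.
have right (e : gval F) : exists J : gval F * option (gval F), [/\ J \in S, ~~ thin J, J.1 <= e &
    forall h : gval F, J.2 = Some h -> e < h].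
  have [y _ ey] := nuv_gt_ex hG e.
  by apply: (cover_right hF hG ey) => x tx _ _; apply: cS.
have [J [JS tJ J0 _]] := right (nuv 0).
have vJ := allP vS _ JS; case eJ: J.2 => [h|]; last first.
  by move: vJ; rewrite /itv_valid eJ ltNge J0.
have Jh : J.1 <= h by move: vJ; rewrite /itv_valid eJ.
have [J' [J'S tJ' J'1 J'2]] := right h.
have eJJ : J = J'.
  apply: (sS J J' h) => //; rewrite /covers ?eJ ?Jh ?lexx // J'1.
  by case e': J'.2 => [h'|//]; rewrite ltW ?J'2.
by have := J'2 h; rewrite -eJJ eJ ltxx => /(_ erefl).
Qed.

Section Compare.
Variables (f : {poly F}) (c0 : F) (T0 : seq (F * option F)).
Hypotheses (tc0 : c0 \in tangible) (vT0 : all (@gi_valid F) T0).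
Hypothesis fE : forall x, x \in tangible -> f.[x] = c0 * gi_prod T0 x.
Hypothesis sT0 : separated (map (@nuv_itv F) T0).
Hypothesis uT0 : uniq (filter (@thick F) (map (@nuv_itv F) T0)).

(** The polynomial has a tangible value in the gap between the runs. *)
Lemma factorization_const c s : factorization f c s -> c \in tangible.
Proof.
move=> fs; have [iv [_ vT [u tu sE] _ _]] := factor_intervals hF hG fs.
have [x tx nc] := separated_gap (nuv_itv_valid_all vT0) sT0.
have x0 := tangible_neq0 tx.
have : f.[x] \in tangible.
  rewrite tangibleN fE // ghost_mul ?gi_prod_neq0 ?tangible_neq0 //.
  by rewrite (negbTE tc0) /= gi_prod_ghost.
by rewrite sE; apply: contra => gc; apply: ghostM.
Qed.

Lemma factorization_intervals c s : factorization f c s ->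
  exists iv : {poly F} -> F * option F,
  [/\ forall g, g \in s -> interval_of g (iv g),
    (count (@quad_kind F) (map (@nuv_itv F) T0) <= ghost_count s)%N &
    (ghost_count s <= count (@quad_kind F) (map (@nuv_itv F) T0))%N ->
    perm_eq (map (@nuv_itv F) T0) (map (@nuv_itv F) (map iv s))].
Proof.
move=> fs; have tc := factorization_const fs.
have [iv [ivP vT [u tu sE] [ls rs] qs]] := factor_intervals hF hG fs.
have same x : x \in tangible ->
    covered (map (@nuv_itv F) T0) (nuv x) = covered (map (@nuv_itv F) (map iv s)) (nuv x).
  move=> tx; have x0 := tangible_neq0 tx; rewrite -!gi_prod_ghost //.
  have := congr1 (fun z => z \in ghost) (sE x); rewrite /= fE //.
  rewrite mulrA !ghost_mul ?gi_prod_neq0 ?mul_neq0 ?tangible_neq0 //.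
  by rewrite (negbTE tc0) (negbTE tc) (negbTE tu).
have v0 := nuv_itv_valid_all vT0; have v1 := nuv_itv_valid_all vT.
exists iv; split=> //.
  apply: leq_trans qs; exact: (count_quad_le hF hG v0 v1 sT0 uT0 same).
move=> le; apply: (intervals_perm hF hG v0 v1 sT0 uT0 same) => //.
  exact: leq_trans le.
rewrite !value_roots_all //; apply: (roots_perm hF hG (c := c0) (c' := c * u)).
- exact: tangible_neq0.
- by rewrite mul_neq0 ?tangible_neq0.
move=> x tx; rewrite -(nuvM_eq (erefl (nuv c0)) (surp_nuv (gi_prod_surp x vT0))).
rewrite -(nuvM_eq (erefl (nuv (c * u))) (surp_nuv (gi_prod_surp x vT))).
by rewrite -fE // sE mulrA.
Qed.

Lemma reduced_is_factorization : factorization f c0 (map (@gi_poly F) T0).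
Proof.
apply: (gi_factorization hF hG) => //; first exact: tangible_neq0.
  exact: separated_left.
exact: separated_right.
Qed.

Lemma reduced_minimal : minimal_in_ghosts f c0 (map (@gi_poly F) T0).
Proof.
split; first exact: reduced_is_factorization.
move=> c s fs; have [iv [_ le _]] := factorization_intervals fs.
exact: leq_trans (gi_ghost_count hF hG vT0) le.
Qed.

Lemma minimal_intervals c s : minimal_in_ghosts f c s ->
  exists2 iv : {poly F} -> F * option F,
    forall g, g \in s -> interval_of g (iv g) &
    perm_eq (map (@nuv_itv F) T0) (map (fun g => nuv_itv (iv g)) s).
Proof.
case=> fs smin; have [iv [ivP _ pm]] := factorization_intervals fs.
exists iv => //; rewrite map_comp; apply: pm.
exact: leq_trans (smin _ _ reduced_is_factorization) (gi_ghost_count hF hG vT0).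
Qed.

End Compare.

(** Indistinguishable by value and ghost status; this is a congruence. *)
Definition similar a b : Prop := nuv a = nuv b /\ (a \in ghost) = (b \in ghost).

Lemma similar_refl a : similar a a. Proof. by []. Qed.

Lemma similarM a b c d : similar a b -> similar c d -> similar (a * c) (b * d).
Proof.
move=> [vab gab] [vcd gcd]; split; first exact: nuvM_eq.
have e0 y z : nuv y = nuv z -> (y == 0) = (z == 0) by rewrite -!nuv_eq0 => ->.
case: (eqVneq a 0) (e0 _ _ vab) => [->|a0 /esym/negbT b0].
  by move=> /esym/eqP->; rewrite !mul0r.
case: (eqVneq c 0) (e0 _ _ vcd) => [->|n0 /esym/negbT d0].
  by move=> /esym/eqP->; rewrite !mulr0.
by rewrite !ghost_mul // gab gcd.
Qed.

Lemma similarD a b c d : similar a b -> similar c d -> similar (a + c) (b + d).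
Proof.
move=> [vab gab] [vcd gcd]; split; first by rewrite !nuvD vab vcd.
case: (ltgtP (nuv a) (nuv c)) => [lt|gt|e].
- by rewrite (add_vlt lt) (add_vlt (a := b)) // -vab -vcd.
- by rewrite (add_vgt gt) (add_vgt (a := b)) // -vab -vcd.
- by rewrite (add_veq e) (add_veq (a := b)) ?nu_ghost // -vab -vcd.
Qed.

Lemma similar_gi I J x : gi_valid I -> gi_valid J -> nuv_itv I = nuv_itv J ->
  similar (gi_poly I).[x] (gi_poly J).[x].
Proof.
have simT a b : (a == 0) || (a \in tangible) -> (b == 0) || (b \in tangible) ->
    nuv a = nuv b -> similar a b.
  move=> ha hb e; split=> //.
  have gE y : (y == 0) || (y \in tangible) -> (y \in ghost) = (nuv y == nuv 0).
    rewrite nuv_eq0; case: eqP => [-> _|_ /= ty]; first exact: ghost0.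
    exact: negbTE.
  by rewrite !gE // e.
have simN a b : nuv a = nuv b -> similar (nu a) (nu b).
  by move=> e; split; rewrite ?nuv_nu ?nu_ghost.
case: I J => [a h] [a' h'] hI hJ e.
have ea : nuv a = nuv a' := congr1 fst e.
have eh : omap (@nuv F) h = omap (@nuv F) h' := congr1 snd e.
case: h h' hI hJ eh {e} => [b|] [b'|] // hI hJ eh; last first.
  rewrite /= !hornerD !hornerZ !hornerX !hornerC.
  have [ta ta'] : a \in tangible /\ a' \in tangible by [].
  by apply: similarD => //; apply: simT => //; rewrite ?ta ?ta' orbT.
have eb : nuv b = nuv b' by apply: Some_inj.
have eqE y z : gi_valid (y, Some z) -> (y == z) = (nuv y == nuv z).
  move=> hy; case: (eqVneq y z) => [->|ne]; first by rewrite eqxx.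
  by have [_ lt _] := gi_valid_lt hy ne; rewrite lt_eqF.
have e0 : (a == 0) = (a' == 0) by rewrite -!nuv_eq0 ea.
rewrite /= (eqE _ _ hI) (eqE _ _ hJ) -ea -eb -e0; case: ifP => ab.
  rewrite !hornerD !hornerX !hornerC.
  by apply: similarD => //; apply: simT => //; [case/andP: hI | case/andP: hJ].
case: ifP => a0; first by rewrite !hornerD !hornerX !hornerC; apply/similarD/simN.
have [tb _ ta] : [/\ b \in tangible, nuv a < nuv b & (a == 0) || (a \in tangible)].
  by apply: gi_valid_lt => //; rewrite eqE // ab.
have [tb' _ ta'] : [/\ b' \in tangible, nuv a' < nuv b' & (a' == 0) || (a' \in tangible)].
  by apply: gi_valid_lt => //; rewrite eqE // -ea -eb ab.
rewrite !hornerD !hornerXn !hornerZ !hornerX !hornerC.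
apply: similarD; first by apply/similarD => //; apply/similarM => //; apply: simN.
by apply: similarM; [exact: simT | apply: simT; rewrite ?tb ?tb' ?orbT].
Qed.

Lemma interval_associate g h I J : interval_of g I -> interval_of h J ->
  nuv_itv I = nuv_itv J -> nu_associate g h.
Proof.
move=> [u tu [hI gE _ _ _]] [w tw [hJ hE _ _ _]] e.
have w0 := tangible_neq0 tw.
exists (u * tinv w) => [|x]; first by rewrite tangibleM ?tangible_tinv.
have -> : ((u * tinv w) *: h).[x] = u * (gi_poly J).[x].
  by rewrite hornerZ hE -mulrA [tinv w * _]mulrA [tinv w * w]mulrC mulV // mul1r.
rewrite gE; have [/nuvP -> ->] // := similarM (similar_refl u) (similar_gi x hI hJ e).
Qed.

Lemma nu_associate_inj g h : {in tangible &, injective (@nu F)} ->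
  nu_associate g h -> e_associate g h.
Proof.
move=> inj [u tu H]; exists u => // x; have [en eg] := H x.
case: (boolP (g.[x] \in ghost)) => gx; last first.
  by apply: inj => //; rewrite tangibleN -eg.
by rewrite -(nu_id gx) en nu_id // -eg.
Qed.

Lemma perm_map_match (A B : eqType) (x0 : A) (k k' : A -> B) (s1 s2 : seq A) :
  perm_eq (map k s1) (map k' s2) ->
  exists2 s3, perm_eq s3 s2 & map k s1 = map k' s3.
Proof.
move=> pm; have [Is pI e] := perm_iotaP (k' x0) pm.
rewrite size_map in pI; exists (map (nth x0 s2) Is).
  by apply/(perm_iotaP x0); exists Is.
rewrite e -map_comp; apply/eq_in_map => i; rewrite (perm_mem pI) mem_iota.
by move=> /andP[_ lt]; rewrite /= (nth_map x0).
Qed.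

Lemma same_factors_intervals s s' (iv iv' : {poly F} -> F * option F) :
  (forall g, g \in s -> interval_of g (iv g)) ->
  (forall g, g \in s' -> interval_of g (iv' g)) ->
  perm_eq (map (fun g => nuv_itv (iv g)) s) (map (fun g => nuv_itv (iv' g)) s') ->
  same_factors (@nu_associate F) s s'.
Proof.
move=> ivP ivP' /(perm_map_match 0)[s2 pm e]; exists s2 => //.
have sz : size s = size s2 by rewrite -(size_map (fun g => nuv_itv (iv g))) e size_map.
split=> // i isz; apply: (@interval_associate _ _ (iv s`_i) (iv' s2`_i)).
- by apply: ivP; apply: mem_nth.
- by apply: ivP'; rewrite -(perm_mem pm) mem_nth // -sz.
have := congr1 (fun t => nth (nuv_itv (iv 0)) t i) e.
by rewrite (nth_map 0) // (nth_map 0) // -sz.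
Qed.

End Uniqueness.

Theorem theorem8p43 (F : supertropicalSemifieldType)
    (hF : divisibly_closed F)
    (hG : exists2 a : F, a \in tangible & nu a <> nu 1)
    (f : {poly F}) (hf0 : f <> 0) (hf : full f) :
  (exists (c : F) (s : seq {poly F}),
      minimal_in_ghosts f c s /\
      ((exists i : nat, f`_i \in tangible) \/
         (2 < count (predC1 (0%R : F)) f)%N ->
       c \in tangible)) /\
  ((exists i : nat, f`_i \in tangible) ->
   forall (c c' : F) (s s' : seq {poly F}),
     minimal_in_ghosts f c s -> minimal_in_ghosts f c' s' ->
     same_factors (@nu_associate F) s s' /\
     ({in tangible &, injective (@nu F)} ->
      same_factors (@e_associate F) s s')).
Proof.
split; last first.
  move=> ht c c' s s' ms ms'.
  have [c0 [T0 [tc vT fE sT uT]]] := reduced_factorization hF hf0 hf ht.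
  have [iv ivP pm] := minimal_intervals hF hG tc vT fE sT uT ms.
  have [iv' ivP' pm'] := minimal_intervals hF hG tc vT fE sT uT ms'.
  have same : same_factors (@nu_associate F) s s'.
    by apply: same_factors_intervals ivP ivP' _; rewrite -(permPl pm).
  split=> // inj; have [s2 p2 [sz nuP]] := same.
  by exists s2 => //; split=> // i /nuP; apply: nu_associate_inj.
case: (pselect (exists i : nat, f`_i \in tangible)) => ht.
  have [c0 [T0 [tc vT fE sT uT]]] := reduced_factorization hF hf0 hf ht.
  exists c0, (map (@gi_poly F) T0); split=> //.
  exact: reduced_minimal.
have [c [T [c0 vT fE [lT rT qT] tc]]] := ghost_factorization hF hf0 hf ht.
exists c, (map (@gi_poly F) T); split; last by case=> [/ht|/tc].
split; first exact: gi_factorization.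
move=> c' s' _; apply: leq_trans (gi_ghost_count hF hG vT) _.
by rewrite qT.
Qed.
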